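(* Let $\{w_k\}_{k\ge 0}=\{(x_k,y_k)\}_{k\ge 0}\subseteq\mathcal F^\circ\times\mathbb R^m_{++}$ and $\{\mu_k\}_{k\ge 0}\subset(0,\infty)$ with $\lim_{k\to\infty}\mu_k=0$ be sequences generated by the outer iteration, and let $x^*\in\mathcal F$ be any accumulation point of $\{x_k\}$. (1) Suppose that for every $k\ge 0$ the point $w_{k+1}$ satisfies, with barrier parameter $\mu_k$, $$\|\operatorname{grad}_x\mathcal L(w_{k+1})\|_{x_{k+1}}\le\varphi_1(\mu_k),\quad \|Y_{k+1}g(x_{k+1})-\mu_k\mathbf 1\|\le\varphi_2(\mu_k),\quad g(x_{k+1})>0,\ y_{k+1}>0 .$$ Then $x^*$ is an AKKT point of the problem. (2) Suppose in addition that: - for every $k\ge0$, $\lambda_{\min}[H(w_{k+1})]\ge-\varphi_3(\mu_k)$; - the linear independence constraint qualification holds at $x^*$, i.e. $\{\operatorname{grad}g_i(x^* )\}_{i\in\mathcal A(x^* )}$ is linearly independent in $T_{x^*}\mathcal M$; - for each $\phi\in\{f,g_1,\dots,g_m\}$ there are $C_\phi>0$ and a closed neighborhood $\mathcal V_\phi$ of $x^*$ such that for all $x\in\mathcal V_\phi$ $$\|\operatorname{Hess}\phi(x^* )-P_{x^*\leftarrow x}\circ\operatorname{Hess}\phi(x)\circ P_{x\leftarrow x^*}\|_{\rm op}\le C_\phi\,\operatorname{dist}(x,x^* ).$$ Then there is a Lagrange multiplier vector $y^*$ associated with $x^*$ such that $x^*$ is a weak second-order stationary point with multiplier $y^*$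.
   Context: $\mathcal M$ is a finite-dimensional, connected, complete Riemannian manifold with metric $\langle\cdot,\cdot\rangle_x$, norm $\|\cdot\|_x$ and Riemannian distance $\operatorname{dist}$; $f,g_1,\dots,g_m:\mathcal M\to\mathbb R$ are $C^2$. The problem is: minimize $f(x)$ over $x\in\mathcal M$ subject to $g_i(x)\ge0$, $i\in\mathcal I=\{1,\dots,m\}$. $g=(g_1,\dots,g_m)$; $\mathcal F=\{x: g_i(x)\ge0\ \forall i\}$, $\mathcal F^\circ=\{x: g_i(x)>0\ \forall i\}$, $\mathcal A(x)=\{i: g_i(x)=0\}$. $\operatorname{grad}$, $\operatorname{Hess}$ are the Riemannian gradient and Hessian (Levi-Civita connection). For $w=(x,y)\in\mathcal M\times\mathbb R^m$: $\mathcal L(w)=f(x)-\sum_i y_ig_i(x)$, $\operatorname{grad}_x\mathcal L(w)=\operatorname{grad}f(x)-\sum_iy_i\operatorname{grad}g_i(x)$, $\operatorname{Hess}_x\mathcal L(w)=\operatorname{Hess}f(x)-\sum_iy_i\operatorname{Hess}g_i(x)$. For $x\in\mathcal F^\circ$, $H(w):T_x\mathcal M\to T_x\mathcal M$ is $H(w)[\xi]=\operatorname{Hess}_x\mathcal L(w)[\xi]+\sum_i\frac{y_i}{g_i(x)}\langle\operatorname{grad}g_i(x),\xi\rangle_x\operatorname{grad}g_i(x)$, and $\lambda_{\min}[\cdot]$ is the minimum eigenvalue. $Y_k=\operatorname{diag}(y_k)$, $\mathbf 1$ is the all-ones vector, $\|\cdot\|_{\rm op}$ the operator norm. $\varphi_1,\varphi_2,\varphi_3:[0,\infty)\to[0,\infty)$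 are fixed forcing functions: continuous, with $\varphi_j(\mu)=0$ iff $\mu=0$. Outer iteration: starting from $w_0\in\mathcal F^\circ\times\mathbb R^m_{++}$, at each $k$ a barrier parameter $\mu_k>0$ is chosen (with $\mu_k\to0$) and $w_{k+1}\in\mathcal F^\circ\times\mathbb R^m_{++}$ is any point satisfying the stopping conditions displayed in the claim for $\mu_k$ (the $\lambda_{\min}$ condition being imposed only in the second-order version of the method). $P_{x_2\leftarrow x_1}:T_{x_1}\mathcal M\to T_{x_2}\mathcal M$ is parallel transport along the unique minimizing geodesic joining $x_1$ and $x_2$, for $x_2$ sufficiently close to $x_1$ (neighborhoods are understood small enough for this). $x^*$ is an AKKT (approximate KKT) point if there exist sequences $\{x_n\}\subseteq\mathcal M$, $\{y_n\}\subseteq\mathbb R^m_{+}$ with $x_n\to x^*$, $\|\operatorname{grad}_x\mathcal L(x_n,y_n)\|_{x_n}\to0$ and $\sum_{i}\max\{(y_n)_ig_i(x_n),0\}\to0$. $x^*$ is a KKT point with Lagrange multiplier vector $y^*$ if $\operatorname{grad}_x\mathcal L(x^*,y^* )=0$, and $y^*_i\ge0$, $g_i(x^* )\ge0$, $y_i^*g_i(x^* )=0$ for all $i$. $x^*$ is a weak second-order stationary point with multiplier $y^*$ if it is a KKT point with multiplier $y^*$ and $\langle\operatorname{Hess}_x\mathcal L(x^*,y^* )[\xi],\xi\rangle_{x^*}\ge0$ for all $\xi\in T_{x^*}\mathcal M$ with $\langle\operatorname{grad}g_i(x^* ),\xi\rangle_{x^*}=0$ for all $i\in\mathcal A(x^*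 )$. *)

(* Defs.v *)
From HB Require Import structures.
From mathcomp Require Import all_boot all_order all_algebra.
From mathcomp Require Import all_classical all_reals all_analysis.

Set Implicit Arguments.
Unset Strict Implicit.
Unset Printing Implicit Defensive.

Import Order.TTheory GRing.Theory Num.Theory.
Import numFieldNormedType.Exports.

Local Open Scope classical_set_scope.
Local Open Scope ring_scope.

Section Calculus.
Context {R : realType} {n : nat}.

Definition partial (a : 'I_n) (f : 'rV[R]_n -> R) (u : 'rV[R]_n) : R :=
  'D_(delta_mx 0 a) f u.

(* class C^k on U, which is meant to be open *)
Fixpoint Ck_on (k : nat) (U : set 'rV[R]_n) (f : 'rV[R]_n -> R) : Prop :=
  (forall u, U u -> {for u, continuous f}) /\
  (if k is k'.+1 then
     forall a, (forall u, U u -> derivable f u (delta_mx 0 a)) /\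
               Ck_on k' U (partial a f)
   else True).

Definition smooth_on (U : set 'rV[R]_n) (f : 'rV[R]_n -> R) : Prop :=
  forall k, Ck_on k U f.

End Calculus.

(* An n-dimensional smooth manifold, given by an atlas that need not be
   maximal.  [dom i] is the domain of the chart [phi i], and [psi i] is its
   inverse, relevant only on the open set [phi i @` dom i].  Every point [x]
   is given a preferred chart [chart_at x], used below to represent tangent
   vectors. *)
Record smoothManifold (R : realType) (n : nat) := SmoothManifold {
  point :> topologicalType ;
  point_hausdorff : hausdorff_space point ;
  point_second_countable : @second_countable point ;
  chart : Type ;
  dom : chart -> set point ;
  phi : chart -> point -> 'rV[R]_n ;
  psi : chart -> 'rV[R]_n -> point ;
  dom_open : forall i, open (dom i) ;
  image_open : forall i, open (phi i @` dom i) ;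
  phiK : forall i x, dom i x -> psi i (phi i x) = x ;
  phi_continuous : forall i x, dom i x -> {for x, continuous (phi i)} ;
  psi_continuous : forall i u, (phi i @` dom i) u ->
    {for u, continuous (psi i)} ;
  transition_smooth : forall i j (b : 'I_n),
    smooth_on (phi i @` (dom i `&` dom j)) (fun u => phi j (psi i u) 0 b) ;
  chart_at : point -> chart ;
  chart_atP : forall x, dom (chart_at x) x
}.

Arguments dom {R n s} i _.
Arguments phi {R n s} i _.
Arguments psi {R n s} i _.
Arguments chart_at {R n s} x.

Section Manifold.
Context {R : realType} {n : nat} {M : smoothManifold R n}.

(* Row-vector convention: a vector at [x] with components [v] in the chart [i]
   has components [v *m jac i j x] in the chart [j]. *)
Definition jac (i j : chart M) (x : M) : 'M[R]_n :=
  \matrix_(a, b) partial a (fun u => phi j (psi i u) 0 b) (phi i x).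

(* T_x M; vectors are represented by their components in [chart_at x]. *)
Definition tangent (x : M) : Type := 'rV[R]_n.

Definition in_chart (i : chart M) (x : M) (v : tangent x) : 'rV[R]_n :=
  v *m jac (chart_at x) i x.

Definition Ck (k : nat) (f : M -> R) : Prop :=
  forall i : chart M, Ck_on k (phi i @` dom i) (f \o psi i).

(* Df(x)[v] *)
Definition differential (f : M -> R) (x : M) (v : tangent x) : R :=
  \sum_a v 0 a * partial a (f \o psi (chart_at x)) (phi (chart_at x) x).

Definition C1_at (c : R -> M) (t : R) : Prop :=
  {for t, continuous c} /\
  forall i : chart M, dom i (c t) ->
    (\forall s \near t, derivable (phi i \o c) s 1) /\
    {for t, continuous (fun s => 'D_1 (phi i \o c) s)}.

Definition velocity (c : R -> M) (t : R) : tangent (c t) :=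
  'D_1 (phi (chart_at (c t)) \o c) t.

End Manifold.

Arguments tangent {R n} M x.
Arguments in_chart {R n M} i x v.
Arguments differential {R n M} f x v.

(* [gram i u] is the matrix of the metric, in the chart [i], at the point with
   coordinates [u]. *)
Record riemannianManifold (R : realType) (n : nat) := RiemannianManifold {
  manifold :> smoothManifold R n ;
  gram : chart manifold -> 'rV[R]_n -> 'M[R]_n ;
  gram_smooth : forall i a b,
    smooth_on (phi i @` dom i) (fun u => gram i u a b) ;
  gram_sym : forall i u, (phi i @` dom i) u -> (gram i u)^T = gram i u ;
  gram_pos : forall i u (v : 'rV[R]_n), (phi i @` dom i) u -> v != 0 ->
    0 < (v *m gram i u *m v^T) 0 0 ;
  gram_compat : forall (i j : chart manifold) (x : manifold),
    dom i x -> dom j x ->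
    gram i (phi i x) = jac i j x *m gram j (phi j x) *m (jac i j x)^T
}.

Section Riemannian.
Context {R : realType} {n : nat} {M : riemannianManifold R n}.

Definition metric (x : M) (v w : tangent M x) : R :=
  (v *m gram (chart_at x) (phi (chart_at x) x) *m w^T) 0 0.

Definition tnorm (x : M) (v : tangent M x) : R := Num.sqrt (metric v v).

(* P t for all t in some open interval containing [0, 1] *)
Definition around01 (P : R -> Prop) : Prop :=
  exists2 e : R, 0 < e & forall t, - e < t < 1 + e -> P t.

Definition curve_length (c : R -> M) : R :=
  \int[lebesgue_measure]_(t in `[0, 1]) tnorm (velocity c t).

(* [pw_joined x y l]: a piecewise C^1 curve of length [l] goes from [x] to [y].
   It is a concatenation of C^1 pieces, each reparametrized by [0, 1]. *)
Inductive pw_joined : M -> M -> R -> Prop :=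
| pw_joined_refl x : pw_joined x x 0
| pw_joined_cons c y l : around01 (C1_at c) -> pw_joined (c 1) y l ->
    pw_joined (c 0) y (curve_length c + l).

Definition dist (x y : M) : R := inf [set l | pw_joined x y l].

(* Gamma^c_{ab} of the Levi-Civita connection, in the chart [i] *)
Definition christoffel (i : chart M) (u : 'rV[R]_n) (a b c : 'I_n) : R :=
  2^-1 * \sum_d invmx (gram i u) c d *
    (partial a (fun z => gram i z b d) u + partial b (fun z => gram i z a d) u
     - partial d (fun z => gram i z a b) u).

Definition christoffel_form (i : chart M) (u v w : 'rV[R]_n) : 'rV[R]_n :=
  \row_c \sum_a \sum_b christoffel i u a b c * v 0 a * w 0 b.

(* nabla_v X at x for a vector field X *)
Definition nabla (X : forall x : M, tangent M x) (x : M) (v : tangent M x) :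
    tangent M x :=
  let i := chart_at x in
  let Xi u := in_chart i (psi i u) (X (psi i u)) in
  (\row_c \sum_a v 0 a * partial a (fun u => Xi u 0 c) (phi i x))
  + christoffel_form i (phi i x) v (X x).

(* the covariant derivative DV/dt exists at time t and vanishes *)
Definition parallel_at (c : R -> M) (V : forall t, tangent M (c t)) (t : R) :
    Prop :=
  let i := chart_at (c t) in
  let Vi s := in_chart i (c s) (V s) in
  derivable Vi t 1 /\
  'D_1 Vi t + christoffel_form i (phi i (c t)) (velocity c t) (V t) = 0.

Definition geodesic (c : R -> M) : Prop :=
  around01 (fun t => C1_at c t /\ parallel_at (velocity c) t).

Definition minimizing_geodesic (x1 x2 : M) (c : R -> M) : Prop :=
  [/\ geodesic c, c 0 = x1, c 1 = x2 & curve_length c = dist x1 x2].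

Definition unique_minimizing_geodesic (x1 x2 : M) : Prop :=
  exists2 c, minimizing_geodesic x1 x2 c &
    forall c', minimizing_geodesic x1 x2 c' ->
      forall t, 0 <= t <= 1 -> c' t = c t.

(* P_{x2 <- x1}; meaningful when [unique_minimizing_geodesic x1 x2] *)
Definition transport (x1 x2 : M) (v : tangent M x1) : tangent M x2 :=
  xget (0 : 'rV[R]_n) [set w : 'rV[R]_n |
    exists (c : R -> M) (V : forall t, tangent M (c t)),
    [/\ minimizing_geodesic x1 x2 c, around01 (parallel_at V),
        V 0 = v :> 'rV[R]_n & V 1 = w :> 'rV[R]_n]].

(* components g^{ab} d_a f *)
Definition grad (f : M -> R) (x : M) : tangent M x :=
  let i := chart_at x in
  (\row_a partial a (f \o psi i) (phi i x)) *m invmx (gram i (phi i x)).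

Definition hess (f : M -> R) (x : M) (v : tangent M x) : tangent M x :=
  nabla (grad f) v.

(* the infimum is a minimum for a self-adjoint A on a nonzero space *)
Definition lambda_min (x : M) (A : tangent M x -> tangent M x) : R :=
  inf [set a | eigenvalue (lin1_mx (A : 'rV[R]_n -> 'rV[R]_n)) a].

Definition op_norm (x : M) (A : tangent M x -> tangent M x) : R :=
  sup [set tnorm (A v) | v in [set v : tangent M x | tnorm v <= 1]].

End Riemannian.

Arguments metric {R n M} x v w.
Arguments tnorm {R n M} x v.
Arguments transport {R n M} x1 x2 v.
Arguments hess {R n M} f x v.
Arguments lambda_min {R n M} x A.
Arguments op_norm {R n M} x A.

Lemma metric_grad (R : realType) (n : nat) (M : riemannianManifold R n)
  (f : M -> R) (x : M) (v : tangent M x) :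
  metric x (grad f x) v = differential f x v.
Proof.
rewrite /metric /grad /differential; set i := chart_at x.
have ix : (phi i @` dom i) (phi i x) by exists x => //; exact: chart_atP.
have Gu : gram i (phi i x) \in unitmx.
  rewrite -row_free_unit -kermx_eq0; apply/negPn/negP => /rowV0Pn[w wK w0].
  have := gram_pos ix w0.
  by rewrite (sub_kermxP wK) mul0mx mxE ltxx.
rewrite mulmxKV// mxE; apply: eq_bigr => a _.
by rewrite !mxE mulrC.
Qed.

(* A Riemannian manifold is complete when it is so as a metric space. *)
Definition complete_manifold (R : realType) (n : nat)
    (M : riemannianManifold R n) : Prop :=
  forall u : nat -> M,
    (forall e : R, 0 < e -> exists N : nat, forall p q : nat,
       (N <= p)%N -> (N <= q)%N -> dist (u p) (u q) < e) ->
    exists x : M, u @ \oo --> x.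

Definition forcing_function (R : realType) (h : R -> R) : Prop :=
  [/\ {within [set t | 0 <= t], continuous h},
      forall t, 0 <= t -> 0 <= h t &
      forall t, 0 <= t -> (h t = 0 <-> t = 0)].

Definition euclidean_norm (R : realType) (m : nat) (v : 'rV[R]_m) : R :=
  Num.sqrt (\sum_i v 0 i ^+ 2).

Section Problem.
Context {R : realType} {n : nat} {M : riemannianManifold R n} {m : nat}.
Variables (f : M -> R) (g : 'I_m -> M -> R).

Definition feasible (x : M) : Prop := forall i, 0 <= g i x.
Definition strictly_feasible (x : M) : Prop := forall i, 0 < g i x.
Definition active (x : M) : {set 'I_m} := [set i | g i x == 0].

Definition constraint_row (x : M) : 'rV[R]_m := \row_i g i x.

Definition gradL (x : M) (y : 'rV[R]_m) : tangent M x :=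
  (grad f x : 'rV[R]_n) - \sum_i y 0 i *: (grad (g i) x : 'rV[R]_n).

Definition hessL (x : M) (y : 'rV[R]_m) (v : tangent M x) : tangent M x :=
  (hess f x v : 'rV[R]_n) - \sum_i y 0 i *: (hess (g i) x v : 'rV[R]_n).

(* the operator H(x, y) *)
Definition condensed_hess (x : M) (y : 'rV[R]_m) (v : tangent M x) :
    tangent M x :=
  (hessL y v : 'rV[R]_n) +
  \sum_i (y 0 i / g i x * metric x (grad (g i) x) v)
    *: (grad (g i) x : 'rV[R]_n).

Definition AKKT (xs : M) : Prop :=
  exists (x : nat -> M) (y : nat -> 'rV[R]_m),
  [/\ forall k i, 0 <= y k 0 i,
      x @ \oo --> xs,
      (fun k => tnorm (x k) (gradL (x k) (y k))) @ \oo --> (0 : R) &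
      (fun k => \sum_i Num.max (y k 0 i * g i (x k)) 0) @ \oo --> (0 : R)].

Definition KKT (xs : M) (ys : 'rV[R]_m) : Prop :=
  gradL xs ys = (0 : 'rV[R]_n) /\
  forall i, [/\ 0 <= ys 0 i, 0 <= g i xs & ys 0 i * g i xs = 0].

Definition weak_second_order_stationary (xs : M) (ys : 'rV[R]_m) : Prop :=
  KKT xs ys /\
  forall v : tangent M xs,
    (forall i, i \in active xs -> metric xs (grad (g i) xs) v = 0) ->
    0 <= metric xs (hessL ys v) v.

Definition LICQ (xs : M) : Prop :=
  free [seq (grad (g i) xs : 'rV[R]_n) | i in active xs].

Definition first_order_stop (h1 h2 : R -> R) (mu : R) (x : M) (y : 'rV[R]_m) :
    Prop :=
  [/\ tnorm x (gradL x y) <= h1 mu,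
      euclidean_norm (constraint_row x *m diag_mx y - const_mx mu) <= h2 mu,
      strictly_feasible x &
      forall i, 0 < y 0 i].

End Problem.

(* The neighborhood V is small enough for the parallel transports between
   [xs] and the points of V to make sense. *)
Definition hess_lipschitz_at (R : realType) (n : nat)
    (M : riemannianManifold R n) (h : M -> R) (xs : M) : Prop :=
  exists (C : R) (V : set M),
  [/\ 0 < C, closed V, nbhs xs V,
      forall x, V x -> unique_minimizing_geodesic xs x /\
                       unique_minimizing_geodesic x xs &
      forall x, V x ->
        op_norm xs (fun v => (hess h xs v : 'rV[R]_n) -
          (transport x xs (hess h x (transport xs x v)) : 'rV[R]_n))
        <= C * dist x xs].

(* Main.v *)
(* Everything is read off in the preferred chart around [xs].  Along a
   subsequence the iterates converge in this chart; the independence of the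
   active gradients provides a matrix [W] dual to them, which turns the
   stationarity residual into a nearly invertible linear system for the
   multipliers, so these converge, the inactive ones to 0 by complementarity.
   The same [W] corrects a critical vector at [xs] into vectors tangent to the
   active constraints at the iterates.  There the rank-one terms of H(w) with
   active index vanish and those with inactive index tend to 0, so the
   eigenvalue bound passes to the limit.

   Tangent vectors at an iterate are expressed in an unrelated chart, so the
   Hessian has to be compared in two charts.  With [X] the gradient field,
   [2 <Hess f v, v> = (L_X g)(v, v)], whose coordinate invariance needs only
   the chain rule and the symmetry of second derivatives. *)
From HB Require Import structures.
Require Import Defs.
From mathcomp Require Import all_boot all_order all_algebra.
From mathcomp Require Import all_classical all_reals all_analysis.
From mathcomp Require Import ring lra.

Set Implicit Arguments.
Unset Strict Implicit.
Unset Printing Implicit Defensive.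

Import Order.TTheory GRing.Theory Num.Theory.
Import numFieldNormedType.Exports.

Local Open Scope classical_set_scope.
Local Open Scope ring_scope.

(** Nothing makes [chart_at x] depend continuously on [x], so neither the components of tangent
    vectors at the iterates nor the matrix of H(w) can be expected to converge. Only numbers of the
    form <A v, v> are passed to the limit, with [v] prescribed by its components in the fixed chart.
    Quadratic forms suffice because H(w) is self-adjoint: its eigenvalue bound becomes a bound on
    its form. As [lambda_min] is an infimum over a set of eigenvalues, this rests on showing that
    the minimum of the Rayleigh quotient is attained at an eigenvector.

    The corrected vectors have to be exactly tangent to the active constraints, not just
    asymptotically: for active [i] the coefficient y_i / g_i may blow up, so a small but nonzero
    contribution could survive in the limit. Inverting a perturbation of the identity gives this
    exactness.

    The class [Ck] speaks of partial derivatives only, whereas changes of charts need the chain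
    rule, hence the passage to total differentiability. *)

Lemma cvg_sumr (K : numFieldType) (V : normedModType K) (T I : Type)
    (F : set_system T) {FF : Filter F} (r : seq I) (P : pred I)
    (h : I -> T -> V) (l : I -> V) :
  (forall i, P i -> h i x @[x --> F] --> l i) ->
  \sum_(i <- r | P i) h i x @[x --> F] --> \sum_(i <- r | P i) l i.
Proof. by move=> hl; apply: cvg_big => //; exact: add_continuous. Qed.

(** [differentiable] refers to the chosen differential ['d f x]; uniqueness of the linear
    approximation identifies it with the candidate [df]. *)
Lemma differentiable_near (K : numFieldType) (V W : normedModType K)
    (f : V -> W) (df : {linear V -> W}) (x : V) :
  continuous df ->
  (forall e : K, 0 < e ->
     \forall h \near 0, `|f (h + x) - f x - df h| <= e * `|h|) ->
  differentiable f x.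
Proof.
move=> dfc dfP.
have E : f \o shift x = cst (f x) + df +o_ 0 id.
  apply/eqaddoP => e e0; apply: filterS (dfP e e0) => h.
  by rewrite -addrA -opprD.
by apply/diff_locallyP; rewrite (diff_unique dfc E).
Qed.

(** * Continuous partial derivatives give total differentiability *)

Section PartialDerivatives.
Context {R : realType} {n : nat}.
Implicit Types (f : 'rV[R]_n -> R) (u v w : 'rV[R]_n).

Lemma is_derive_line f u v (t : R) : derivable f (u + t *: v) v ->
  is_derive t 1 (fun s => f (u + s *: v)) ('D_v f (u + t *: v)).
Proof.
move=> fd.
have E : (fun h : R => h^-1 *: (f (u + (h *: 1 + t) *: v) - f (u + t *: v))) =
  (fun h : R => h^-1 *: (f (h *: v + (u + t *: v)) - f (u + t *: v))).
  apply/funext => h; rewrite [h *: 1]mulr1 scalerDl addrCA.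
  by congr (_ *: (f _ - _)); rewrite [u + _]addrCA.
by split; rewrite ?/derivable ?/derive /= E.
Qed.

(** The increment may have either sign, since it will be a coordinate of an arbitrary vector; each
    sign has its own interval for the mean value theorem. *)
Lemma derive_mean f u v (t : R) :
  (forall s : R, `|s| <= `|t| -> derivable f (u + s *: v) v) ->
  exists2 c, `|c| <= `|t| & f (u + t *: v) - f u = t * 'D_v f (u + c *: v).
Proof.
move=> fd; pose h (s : R) := f (u + s *: v).
have hd (s : R) : `|s| <= `|t| -> is_derive s 1 h ('D_v f (u + s *: v)).
  by move=> st; apply: is_derive_line; exact: fd.
have hc (a b : R) : (forall s, s \in `[a, b] -> `|s| <= `|t|) ->
    {within `[a, b], continuous h}.
  move=> ab; apply: continuous_in_subspaceT => s; rewrite inE => /ab /hd hs.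
  by apply: differentiable_continuous; apply/derivable1_diffP.
have h0 : h 0 = f u by rewrite /h scale0r addr0.
have [t0|/ltW t0] := leP 0 t.
  have B (s : R) : s \in `[0, t] -> `|s| <= `|t|.
    by rewrite in_itv/= => /andP[s0 st]; rewrite !ger0_norm.
  have [|c cI E] := @MVT_segment _ h (fun s => 'D_v f (u + s *: v)) 0 t t0 _ (hc _ _ B).
    by move=> s sI; apply: hd; apply: B; exact: subset_itv_oo_cc.
  by exists c; [exact: B|rewrite -h0 -/(h t) E subr0 mulrC].
have B (s : R) : s \in `[t, 0] -> `|s| <= `|t|.
  by rewrite in_itv/= => /andP[s0 st]; rewrite !ler0_norm// lerN2.
have [|c cI E] := @MVT_segment _ h (fun s => 'D_v f (u + s *: v)) t 0 t0 _ (hc _ _ B).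
  by move=> s sI; apply: hd; apply: B; exact: subset_itv_oo_cc.
exists c; first exact: B.
by rewrite -h0 -/(h t) -opprB E sub0r mulrN opprK mulrC.
Qed.

Lemma norm_delta_mx (a : 'I_n) : `|delta_mx 0 a : 'rV[R]_n| <= 1.
Proof.
rewrite [leLHS]/Num.Def.normr/= mx_normrE; apply: bigmax_le => // -[i j] _.
by rewrite mxE; case: (_ && _); rewrite ?normr1 ?normr0.
Qed.

Definition gradient_form (c : 'I_n -> R) (h : 'rV[R]_n) : R^o := \sum_a h 0 a * c a.

Lemma gradient_form_is_linear c : linear (gradient_form c).
Proof.
move=> k h h'; rewrite /gradient_form scaler_sumr -big_split/=.
by apply: eq_bigr => a _; rewrite !mxE mulrDl -mulrA.
Qed.

HB.instance Definition _ c := GRing.isLinear.Build R 'rV[R]_n R^o *:%R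
  (gradient_form c) (gradient_form_is_linear c).

Lemma continuous_gradient_form c : continuous (gradient_form c).
Proof.
move=> h; apply: (@cvg_sumr R R _ _ (nbhs h)) => a _; apply: cvgMr_tmp.
exact: coord_continuous.
Qed.

(** The path from [u] to [u + h] changes one coordinate at a time. The mean value theorem evaluates
    each step, and continuity of the partial derivative replaces the intermediate point by [u]. *)
Lemma partial_differentiable f u :
  (\forall z \near u, forall a, derivable f z (delta_mx 0 a)) ->
  (forall a, {for u, continuous (partial a f)}) -> differentiable f u.
Proof.
move=> fd fc; pose c a := partial a f u.
pose D : {linear 'rV[R]_n -> R^o} := gradient_form c.
apply: (@differentiable_near _ _ _ _ D); first exact: continuous_gradient_form.
move=> e e0.
(* There are [n] coordinate steps, each allowed an error [d * |h|]; [n.+1] keeps the quotient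
   meaningful when [n = 0]. *)
pose d : R := e / n.+1%:R.
have d0 : 0 < d by rewrite divr_gt0.
have /nbhs_ballP[r /= r0 rP] : \forall z \near u,
   (forall a, derivable f z (delta_mx 0 a)) /\
   (forall a, `|partial a f z - c a| <= d).
  near=> z; split; first by near: z.
  near: z; apply: filter_forall => a.
  have /cvgrPdist_le /(_ d d0) := fc a.
  by apply: filterS => z; rewrite distrC.
near=> h.
have hr : `|h| < r by near: h; exact: (@nbhs0_lt R 'rV[R]_n r r0).
(* Truncation of [h] to its first [k] coordinates: the increments between successive truncations
   telescope from 0 to [h]. *)
pose hk k : 'rV[R]_n := \row_j if (j < k)%N then h 0 j else 0.
have h0 : hk 0 = 0 by apply/rowP => j; rewrite !mxE.
have hn : hk n = h by apply/rowP => j; rewrite !mxE ltn_ord.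
have hkS (a : 'I_n) : hk a.+1 = hk a + h 0 a *: delta_mx 0 a.
  apply/rowP => j; rewrite !mxE eqxx/= ltnS leq_eqVlt -val_eqE/=.
  case: eqVneq => [/val_inj ->|ja]/=; first by rewrite ltnn add0r mulr1.
  by rewrite mulr0 addr0.
have ent (j : 'I_n) : `|h 0 j| <= `|h|.
  rewrite [leRHS]/Num.Def.normr/= mx_normrE.
  exact: (le_bigmax _ _ (0, j)).
(* In the sup norm a truncation of [h] is no longer than [h], so the whole path stays in the
   ball. *)
have hB (a : 'I_n) (s : R) : `|s| <= `|h 0 a| -> ball u r (u + hk a + s *: delta_mx 0 a).
  move=> sh; rewrite -ball_normE/= -addrA opprD addNKr normrN.
  apply: le_lt_trans hr.
  rewrite [leLHS]/Num.Def.normr/= mx_normrE; apply: bigmax_le => // -[i j] _.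
  rewrite !mxE ord1 eqxx/=; case: (eqVneq j a) => [->|ja].
    by rewrite ltnn add0r mulr1 (le_trans sh).
  by rewrite mulr0 addr0; case: ifP; rewrite ?normr0.
have step (a : 'I_n) :
    `|f (u + hk a.+1) - f (u + hk a) - h 0 a * c a| <= d * `|h|.
  rewrite hkS addrA.
  have [|s sh ->] := @derive_mean f (u + hk a) (delta_mx 0 a) (h 0 a).
    by move=> s /hB /rP[+ _]; apply.
  rewrite -mulrBr normrM mulrC; apply: ler_pM => //.
  by have /rP[_] := hB _ _ sh; apply.
have -> : f (h + u) - f u - D h =
    \sum_(a < n) (f (u + hk a.+1) - f (u + hk a) - h 0 a * c a).
  rewrite sumrB -(big_mkord xpredT (fun k => f (u + hk k.+1) - f (u + hk k))).
  by rewrite telescope_sumr// hn h0 addr0 [h + u]addrC.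
apply: (le_trans (ler_norm_sum _ _ _)).
apply: (@le_trans _ _ (\sum_(a < n) d * `|h|)); first exact: ler_sum.
rewrite sumr_const card_ord -mulr_natl mulrA; apply: ler_wpM2r => //.
rewrite /d mulrCA -[leRHS]mulr1 ler_pM2l// ler_pdivrMr// mul1r ler_nat.
exact: leqnSn.
Unshelve. all: by end_near. Qed.

End PartialDerivatives.

Lemma dist_le_half (K : realFieldType) (e p q p' q' : K) : p' = q' ->
  `|p - p'| <= e / 2 -> `|q - q'| <= e / 2 -> `|p - q| <= e.
Proof.
move=> <- pp qp; rewrite [e]splitr -(subrKA p').
by rewrite (le_trans (ler_normD _ _))// lerD// distrC.
Qed.

(** * Symmetry of second partial derivatives *)

Section Schwarz.
Context {R : realType} {n : nat}.
Implicit Types (f : 'rV[R]_n -> R) (u v w : 'rV[R]_n) (U : set 'rV[R]_n).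

Lemma is_derive_translate f u v w : derivable f (u + w) v ->
  is_derive u v (fun z => f (z + w)) ('D_v f (u + w)).
Proof.
move=> fd.
have E : (fun h : R => h^-1 *: (f (h *: v + u + w) - f (u + w))) =
  (fun h : R => h^-1 *: (f (h *: v + (u + w)) - f (u + w))).
  by apply/funext => h; rewrite addrA.
by split; rewrite ?/derivable ?/derive /= E.
Qed.

(** The mean value theorem is used twice: in direction [a] for the increment of [f] along [b], then
    in direction [b] for [partial a f]. The bound [2 * t < r] keeps all corners in the ball, also
    when [a = b]. *)
Lemma second_difference_mean f u (a b : 'I_n) (r t : R) : 0 < t -> 2 * t < r ->
  (forall z, ball u r z -> derivable f z (delta_mx 0 a) /\
     derivable (partial a f) z (delta_mx 0 b)) ->
  exists2 z, ball u r z &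
    f (u + t *: delta_mx 0 a + t *: delta_mx 0 b) - f (u + t *: delta_mx 0 a)
    - f (u + t *: delta_mx 0 b) + f u = t * (t * partial b (partial a f) z).
Proof.
move=> t0 tr fd; pose ea : 'rV[R]_n := delta_mx 0 a.
pose eb : 'rV[R]_n := delta_mx 0 b.
have inball (s s' : R) : `|s| <= t -> `|s'| <= t -> ball u r (u + s *: ea + s' *: eb).
  move=> st s't; rewrite -ball_normE/= -addrA opprD addNKr normrN.
  apply: le_lt_trans tr; rewrite mulr_natl mulr2n.
  apply: (le_trans (ler_normD _ _)); rewrite !normrZ.
  by apply: lerD; rewrite -[leRHS]mulr1 ler_pM// norm_delta_mx.
have inball0 (s : R) : `|s| <= t -> ball u r (u + s *: ea).
  move=> st; have := inball s 0 st; rewrite scale0r addr0; apply.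
  by rewrite normr0 ltW.
have tt : `|t| = t by rewrite gtr0_norm.
pose G z := f (z + t *: eb) - f z.
have Gd (s : R) : `|s| <= `|t| ->
    is_derive (u + s *: ea) ea G
      (partial a f (u + s *: ea + t *: eb) - partial a f (u + s *: ea)).
  rewrite tt => st; have [] := fd _ (inball0 _ st).
  have [|d1 _ d2 _] := fd _ (inball s t st _); first by rewrite tt.
  have [d3 d4] := is_derive_translate d1.
  rewrite -[partial a f (_ + t *: eb)]d4.
  by split; [exact: (derivableB d3 d2)|exact: (deriveB d3 d2)].
have [s|c ct E] := @derive_mean _ _ G u ea t; first by case/Gd.
have [s|c' c't E'] := @derive_mean _ _ (partial a f) (u + c *: ea) eb t.
  by move: ct; rewrite tt => ct st; have [] := fd _ (inball c s ct st).
have [_ Gc] := Gd _ ct; rewrite tt in ct c't.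
exists (u + c *: ea + c' *: eb); first exact: inball.
rewrite -E' -Gc -E /G -/ea -/eb opprB addrA.
by rewrite [in RHS]addrAC.
Qed.

(** The second difference is symmetric in [a] and [b], so the two mixed derivatives agree at two
    points that are both close to [u]; continuity brings them to [u]. *)
Lemma partialC f u (a b : 'I_n) :
  (\forall z \near u, [/\ derivable f z (delta_mx 0 a),
     derivable f z (delta_mx 0 b), derivable (partial a f) z (delta_mx 0 b) &
     derivable (partial b f) z (delta_mx 0 a)]) ->
  {for u, continuous (partial b (partial a f))} ->
  {for u, continuous (partial a (partial b f))} ->
  partial b (partial a f) u = partial a (partial b f) u.
Proof.
move=> fd cab cba; apply/eqP; rewrite -subr_eq0 -normr_le0.
apply/ler_addgt0Pr => e e0; rewrite add0r.
have e2 : 0 < e / 2 by rewrite divr_gt0.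
have /cvgrPdist_le/(_ _ e2) {}cab := cab.
have /cvgrPdist_le/(_ _ e2) {}cba := cba.
have /nbhs_ballP[r /= r0 rP] : \forall z \near u,
   [/\ derivable f z (delta_mx 0 a),
     derivable f z (delta_mx 0 b), derivable (partial a f) z (delta_mx 0 b) &
     derivable (partial b f) z (delta_mx 0 a)] /\
   (`|partial b (partial a f) u - partial b (partial a f) z| <= e / 2 /\
   `|partial a (partial b f) u - partial a (partial b f) z| <= e / 2).
  apply: filterS3 fd cab cba => z fz az bz.
  exact: (conj fz (conj az bz)).
pose t := r / 4.
have t0 : 0 < t by rewrite divr_gt0.
have tr : 2 * t < r by rewrite /t; lra.
have [|z1 z1r E1] := @second_difference_mean f u a b r t t0 tr.
  by move=> z /rP[[fa _ fab _] _]; exact: (conj fa fab).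
have [|z2 z2r E2] := @second_difference_mean f u b a r t t0 tr.
  by move=> z /rP[[_ fb _ fba] _]; exact: (conj fb fba).
have : t * (t * partial b (partial a f) z1) = t * (t * partial a (partial b f) z2).
  apply: (etrans (esym E1)); apply: etrans E2; congr (_ + f u).
  by rewrite [LHS]addrAC; congr (f _ - _ - _); exact: addrAC.
move=> /(mulfI (lt0r_neq0 t0)) /(mulfI (lt0r_neq0 t0)) E.
have [_ [H1 _]] := rP _ z1r; have [_ [_ H2]] := rP _ z2r.
exact: dist_le_half E H1 H2.
Qed.

Lemma Ck_onW k U f : Ck_on k.+1 U f -> Ck_on k U f.
Proof.
elim: k f => [|k IH] f [fc fd]; first by split.
split=> // a; have [fa Ca] := fd a; split=> //; exact: IH.
Qed.

Lemma Ck_on_partial k U f a : Ck_on k.+1 U f -> Ck_on k U (partial a f).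
Proof. by move=> [_ /(_ a)[]]. Qed.

Lemma Ck_on_continuous k U f u : Ck_on k U f -> U u -> {for u, continuous f}.
Proof. by case: k => [|k] [+ _]; apply. Qed.

Lemma Ck1_differentiable U f u : open U -> Ck_on 1 U f -> U u ->
  differentiable f u.
Proof.
move=> oU [fc fd] Uu; apply: partial_differentiable.
  have : nbhs u U by exact: open_nbhs_nbhs.
  by apply: filterS => z Uz a; have [+ _] := fd a; apply.
by move=> a; have [_ [+ _]] := fd a; apply.
Qed.

Lemma Ck2_partialC U f u a b : open U -> Ck_on 2 U f -> U u ->
  partial b (partial a f) u = partial a (partial b f) u.
Proof.
move=> oU C2 Uu; have [_ fd] := C2.
have [fa Ca] := fd a; have [fb Cb] := fd b.
apply: partialC.
- have : nbhs u U by exact: open_nbhs_nbhs.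
  apply: filterS => z Uz; split; [exact: fa|exact: fb| |].
    by have [_ /(_ b)[+ _]] := Ca; apply.
  by have [_ /(_ a)[+ _]] := Cb; apply.
- by have [_ /(_ b)[_ [+ _]]] := Ca; apply.
- by have [_ /(_ a)[_ [+ _]]] := Cb; apply.
Qed.

Lemma derive_partial f u v : differentiable f u ->
  'D_v f u = \sum_a v 0 a * partial a f u.
Proof.
move=> fd; rewrite deriveE// [in LHS](row_sum_delta v) linear_sum.
by apply: eq_bigr => a _; rewrite linearZ/= /partial deriveE.
Qed.

End Schwarz.

(** * Entrywise differential calculus of matrix-valued maps *)

Section MatrixCalculus.
Context {R : realType} {n : nat}.
Implicit Types (u v : 'rV[R]_n).

Definition mx_differentiable p q (A : 'rV[R]_n -> 'M[R]_(p, q)) u : Prop :=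
  forall i j, differentiable (fun z => A z i j) u.

Definition mx_derive p q v (A : 'rV[R]_n -> 'M[R]_(p, q)) u : 'M[R]_(p, q) :=
  \matrix_(i, j) 'D_v (fun z => A z i j) u.

Lemma near_eq_differentiable (f g : 'rV[R]_n -> R) u :
  (\forall z \near u, f z = g z) -> differentiable f u -> differentiable g u.
Proof.
move=> fg fd; apply: (@differentiable_near _ _ _ _ ('d f u)).
  exact: diff_continuous.
move=> e e0.
have /diff_locally/eqaddoP/(_ _ e0) := fd.
have fgu : f u = g u by exact: nbhs_singleton fg.
move: fg; rewrite (near_shift 0) subr0 => fg.
apply: filterS2 fg => h /= E; rewrite -[X in `|X| <= _ -> _]/(f (h + u) - (f u + 'd f u h)).
by rewrite opprD addrA -fgu -E.
Qed.

Lemma differentiable_sumr (I : Type) (r : seq I) (P : pred I)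
    (h : I -> 'rV[R]_n -> R) u :
  (forall i, P i -> differentiable (h i) u) ->
  differentiable (fun z => \sum_(i <- r | P i) h i z) u.
Proof.
move=> hd; elim: r => [|i r IH].
  rewrite (_ : (fun _ => _) = cst 0) //.
  by apply/funext => z; rewrite big_nil.
case: (boolP (P i)) => Pi.
  rewrite (_ : (fun _ => _) = (h i \+ fun z => \sum_(i <- r | P i) h i z)).
    by apply: differentiableD => //; exact: hd.
  by apply/funext => z; rewrite big_cons Pi.
rewrite (_ : (fun _ => _) = fun z => \sum_(i <- r | P i) h i z)//.
by apply/funext => z; rewrite big_cons (negbTE Pi).
Qed.

Lemma differentiable_prodr (I : Type) (r : seq I) (P : pred I)
    (h : I -> 'rV[R]_n -> R) u :
  (forall i, P i -> differentiable (h i) u) ->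
  differentiable (fun z => \prod_(i <- r | P i) h i z) u.
Proof.
move=> hd; elim: r => [|i r IH].
  rewrite (_ : (fun _ => _) = cst 1) //.
  by apply/funext => z; rewrite big_nil.
case: (boolP (P i)) => Pi.
  rewrite (_ : (fun _ => _) = (h i \* fun z => \prod_(i <- r | P i) h i z)).
    by apply: differentiableM => //; exact: hd.
  by apply/funext => z; rewrite big_cons Pi.
rewrite (_ : (fun _ => _) = fun z => \prod_(i <- r | P i) h i z)//.
by apply/funext => z; rewrite big_cons (negbTE Pi).
Qed.

Lemma mx_differentiable_det p (A : 'rV[R]_n -> 'M[R]_p) u :
  mx_differentiable A u -> differentiable (fun z => \det (A z)) u.
Proof.
move=> Ad; apply: differentiable_sumr => s _.
by apply: differentiableM => //; apply: differentiable_prodr => i _.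
Qed.

Lemma mx_differentiable_continuous p q (A : 'rV[R]_n -> 'M[R]_(p, q)) u i j :
  mx_differentiable A u -> A z i j @[z --> u] --> A u i j.
Proof. by move=> Ad; apply: differentiable_continuous; exact: Ad. Qed.

Lemma near_unitmx p (A : 'rV[R]_n -> 'M[R]_p) u :
  mx_differentiable A u -> A u \in unitmx ->
  \forall z \near u, A z \in unitmx.
Proof.
move=> /mx_differentiable_det /differentiable_continuous Ac.
rewrite unitmxE unitfE => Au.
have : \forall z \near u, \det (A z) != 0.
  have /cvgr_dist_lt /(_ `|\det (A u)|) := Ac; rewrite normr_gt0 => /(_ Au).
  apply: filterS => z; apply: contraTneq => ->.
  by rewrite subr0 ltxx.
by apply: filterS => z; rewrite unitmxE unitfE.
Qed.

Lemma mx_differentiable_inv p (A : 'rV[R]_n -> 'M[R]_p) u :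
  mx_differentiable A u -> A u \in unitmx ->
  mx_differentiable (fun z => invmx (A z)) u.
Proof.
move=> Ad Au i j.
(* Cramer's formula agrees with [invmx] only where [A z] is invertible, hence the detour through
   equality near [u]. *)
pose h z := (\det (A z))^-1 * cofactor (A z) j i.
apply: (@near_eq_differentiable h).
  have := near_unitmx Ad Au; apply: filterS => z Az.
  by rewrite /invmx Az !mxE.
apply: differentiableM.
  apply: differentiableV; first exact: mx_differentiable_det.
  by rewrite -unitfE -unitmxE.
apply: differentiableM => //.
by apply: mx_differentiable_det => k l; under eq_fun do rewrite !mxE.
Qed.

Lemma mx_differentiableM p q r (A : 'rV[R]_n -> 'M[R]_(p, q))
    (B : 'rV[R]_n -> 'M[R]_(q, r)) u :
  mx_differentiable A u -> mx_differentiable B u ->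
  mx_differentiable (fun z => A z *m B z) u.
Proof.
move=> Ad Bd i j; under eq_fun do rewrite mxE.
by apply: differentiable_sumr => k _; apply: differentiableM.
Qed.

Lemma mx_differentiableT p q (A : 'rV[R]_n -> 'M[R]_(p, q)) u :
  mx_differentiable A u -> mx_differentiable (fun z => (A z)^T) u.
Proof. by move=> Ad i j; under eq_fun do rewrite mxE; exact: Ad. Qed.

Lemma mx_differentiableD p q (A B : 'rV[R]_n -> 'M[R]_(p, q)) u :
  mx_differentiable A u -> mx_differentiable B u ->
  mx_differentiable (fun z => A z + B z) u.
Proof.
by move=> Ad Bd i j; under eq_fun do rewrite mxE; exact: differentiableD.
Qed.

Lemma mx_differentiable_cst p q (C : 'M[R]_(p, q)) u :
  mx_differentiable (fun=> C) u.
Proof. by move=> i j. Qed.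

Lemma mx_derive_near p q v (A B : 'rV[R]_n -> 'M[R]_(p, q)) u :
  (\forall z \near u, A z = B z) -> mx_derive v A u = mx_derive v B u.
Proof.
move=> AB; apply/matrixP => i j; rewrite !mxE; apply: near_eq_derive.
by apply: filterS AB => z ->.
Qed.

Lemma mx_deriveT p q v (A : 'rV[R]_n -> 'M[R]_(p, q)) u :
  mx_derive v (fun z => (A z)^T) u = (mx_derive v A u)^T.
Proof. by apply/matrixP => i j; rewrite !mxE; under eq_fun do rewrite mxE. Qed.

Lemma mx_deriveM p q r v (A : 'rV[R]_n -> 'M[R]_(p, q))
    (B : 'rV[R]_n -> 'M[R]_(q, r)) u :
  mx_differentiable A u -> mx_differentiable B u ->
  mx_derive v (fun z => A z *m B z) u =
  mx_derive v A u *m B u + A u *m mx_derive v B u.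
Proof.
move=> Ad Bd; apply/matrixP => i j; rewrite !mxE.
rewrite (_ : (fun _ => _) = \sum_(k < q) ((fun z => A z i k) * (fun z => B z k j))); last first.
  by apply/funext => z; rewrite mxE fct_sumE.
rewrite derive_sum => [|k]; last first.
  by apply: derivableM; apply: diff_derivable; [exact: Ad|exact: Bd].
rewrite -big_split/=; apply: eq_bigr => k _.
rewrite deriveM; [|by apply: diff_derivable; exact: Ad|by apply: diff_derivable; exact: Bd].
by rewrite !mxE /= addrC; congr (_ + _); rewrite [LHS]mulrC.
Qed.

End MatrixCalculus.

(** * Chain rule in the row-vector convention *)

Section ChainRule.
Context {R : realType} {n : nat}.
Implicit Types (u v w : 'rV[R]_n).

Definition gradient_row (F : 'rV[R]_n -> R) u : 'rV[R]_n := \row_a partial a F u.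

Definition coord_jac (T : 'rV[R]_n -> 'rV[R]_n) u : 'M[R]_n :=
  \matrix_(a, b) partial a (fun z => T z 0 b) u.

Lemma mx_differentiable_row (T : 'rV[R]_n -> 'rV[R]_n) u :
  mx_differentiable T u -> differentiable T u.
Proof.
move=> Td.
have -> : T = \sum_(b < n) (fun z => T z 0 b *: (delta_mx 0 b : 'rV[R]_n)).
  by apply/funext => z; rewrite fct_sumE [LHS]row_sum_delta.
apply: differentiable_sum => b; apply: differentiableZl; exact: Td.
Qed.

Lemma derive_comp (f : 'rV[R]_n -> R) (T : 'rV[R]_n -> 'rV[R]_n) u v :
  mx_differentiable T u -> differentiable f (T u) ->
  'D_v (f \o T) u = 'D_(v *m coord_jac T u) f (T u).
Proof.
move=> Td fd; have Td' := mx_differentiable_row Td.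
rewrite deriveE; last exact: differentiable_comp.
rewrite diff_comp// [RHS]deriveE//=; congr ('d f (T u) _).
rewrite -deriveE// derive_mx; last exact: diff_derivable.
apply/matrixP => i b; rewrite !mxE ord1 derive_partial; last exact: Td.
by apply: eq_bigr => a _; rewrite !mxE.
Qed.

Lemma mx_derive_comp p q v (A : 'rV[R]_n -> 'M[R]_(p, q)) T u :
  mx_differentiable T u -> mx_differentiable A (T u) ->
  mx_derive v (A \o T) u = mx_derive (v *m coord_jac T u) A (T u).
Proof.
by move=> Td Ad; apply/matrixP => i j; rewrite !mxE -derive_comp.
Qed.

Lemma mx_differentiable_comp p q (A : 'rV[R]_n -> 'M[R]_(p, q)) T u :
  mx_differentiable T u -> mx_differentiable A (T u) ->
  mx_differentiable (A \o T) u.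
Proof.
move=> Td Ad i j.
apply: (@differentiable_comp _ _ _ _ T (fun z => A z i j)); last exact: Ad.
exact: mx_differentiable_row.
Qed.

Lemma gradient_row_comp F T u :
  mx_differentiable T u -> differentiable F (T u) ->
  gradient_row (F \o T) u = gradient_row F (T u) *m (coord_jac T u)^T.
Proof.
move=> Td Fd; apply/rowP => a; rewrite !mxE /partial derive_comp//.
rewrite derive_partial//; apply: eq_bigr => b _.
by rewrite -rowE !mxE mulrC.
Qed.

Lemma Ck2_gradient_row U F u : open U -> Ck_on 2 U F -> U u ->
  mx_differentiable (gradient_row F) u.
Proof.
move=> oU C2 Uu i a; under eq_fun do rewrite mxE.
exact: (Ck1_differentiable oU (Ck_on_partial a C2) Uu).
Qed.

End ChainRule.

(** * The Hessian as a bilinear form in coordinates, and its invariance *)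

Section HessianForm.
Context {R : realType} {n : nat}.
Implicit Types (u v w : 'rV[R]_n) (F : 'rV[R]_n -> R) (g : 'rV[R]_n -> 'M[R]_n).

Definition coord_grad F g u : 'rV[R]_n := gradient_row F u *m invmx (g u).

(** This is <Hess F v, w>, with the derivative of the inverse metric inside [coord_grad] traded for
    derivatives of [g]. Its diagonal is half the Lie derivative of [g] along the gradient. *)
Definition hess_form F g u v w : R :=
  (mx_derive v (gradient_row F) u *m w^T) 0 0 +
  2^-1 * ((v *m mx_derive (coord_grad F g u) g u *m w^T) 0 0
    - (coord_grad F g u *m mx_derive v g u *m w^T) 0 0
    - (coord_grad F g u *m mx_derive w g u *m v^T) 0 0).

Lemma trmx11 (A : 'M[R]_1) : A^T 0 0 = A 0 0.
Proof. by rewrite mxE. Qed.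

Lemma form_sym (S : 'M[R]_n) v w : S^T = S ->
  (v *m S *m w^T) 0 0 = (w *m S *m v^T) 0 0.
Proof. by move=> SS; rewrite -trmx11 !trmx_mul trmxK SS mulmxA. Qed.

Section AtPoint.
Variables (U : set 'rV[R]_n) (F : 'rV[R]_n -> R) (g : 'rV[R]_n -> 'M[R]_n).
Hypotheses (oU : open U) (F2 : Ck_on 2 U F)
  (g1 : forall a b, Ck_on 1 U (fun u => g u a b))
  (gS : forall u, U u -> (g u)^T = g u) (gU : forall u, U u -> g u \in unitmx).
Variable u : 'rV[R]_n.
Hypothesis Uu : U u.

Let nU : nbhs u U. Proof. exact: open_nbhs_nbhs. Qed.

Let gd : mx_differentiable g u.
Proof. by move=> a b; exact: Ck1_differentiable (g1 a b) Uu. Qed.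

Let dFd : mx_differentiable (gradient_row F) u.
Proof. exact: Ck2_gradient_row F2 Uu. Qed.

Lemma coord_grad_differentiable : mx_differentiable (coord_grad F g) u.
Proof.
apply: mx_differentiableM => //; apply: mx_differentiable_inv => //; exact: gU.
Qed.

Lemma mx_derive_sym v : (mx_derive v g u)^T = mx_derive v g u.
Proof.
rewrite -mx_deriveT; apply: mx_derive_near.
by apply: filterS nU => z /gS.
Qed.

Lemma coord_gradK : coord_grad F g u *m g u = gradient_row F u.
Proof. by rewrite /coord_grad mulmxKV// gU. Qed.

Lemma second_derivative_sym v w :
  (mx_derive v (gradient_row F) u *m w^T) 0 0 =
  (mx_derive w (gradient_row F) u *m v^T) 0 0.
Proof.
have E x z : (mx_derive x (gradient_row F) u *m z^T) 0 0 =
    \sum_b \sum_a z 0 b * x 0 a * partial a (partial b F) u.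
  rewrite mxE; apply: eq_bigr => b _; rewrite !mxE.
  under [in LHS]eq_fun do rewrite mxE.
  rewrite derive_partial; last exact: Ck1_differentiable (Ck_on_partial b F2) Uu.
  by rewrite mulrC mulr_sumr; apply: eq_bigr => a _; rewrite mulrA.
rewrite !E exchange_big/=; apply: eq_bigr => a _; apply: eq_bigr => b _.
by rewrite (Ck2_partialC _ _ oU F2 Uu) [w _ _ * _]mulrC.
Qed.

Lemma hess_form_sym v w : hess_form F g u v w = hess_form F g u w v.
Proof.
rewrite /hess_form second_derivative_sym; congr (_ + _ * _).
rewrite [LHS]addrAC; congr (_ - _ - _).
exact: form_sym (mx_derive_sym _).
Qed.

Lemma hess_form_diag v : hess_form F g u v v =
  (mx_derive v (gradient_row F) u *m v^T) 0 0 +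
  2^-1 * (v *m mx_derive (coord_grad F g u) g u *m v^T) 0 0
    - (coord_grad F g u *m mx_derive v g u *m v^T) 0 0.
Proof.
have half (a b c : R) : a + 2^-1 * (b - c - c) = a + 2^-1 * b - c by field.
exact: half.
Qed.

(** Product rule for [coord_grad F g *m g = gradient_row F]; the inverse of [g] is never
    differentiated explicitly. *)
Lemma derive_coord_grad v :
  mx_derive v (coord_grad F g) u *m g u =
  mx_derive v (gradient_row F) u - coord_grad F g u *m mx_derive v g u.
Proof.
apply/eqP; rewrite eq_sym subr_eq; apply/eqP.
rewrite -mx_deriveM//; last exact: coord_grad_differentiable.
apply: mx_derive_near; apply: filterS nU => z Uz.
by rewrite /coord_grad mulmxKV// gU.
Qed.

End AtPoint.

Section ChangeOfCoordinates.
Variables (U V : set 'rV[R]_n) (T : 'rV[R]_n -> 'rV[R]_n).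
Variables (F F' : 'rV[R]_n -> R) (g g' : 'rV[R]_n -> 'M[R]_n).
Hypotheses (oU : open U) (oV : open V)
  (TU : forall u, U u -> V (T u))
  (T2 : forall b, Ck_on 2 U (fun u => T u 0 b))
  (F'2 : Ck_on 2 V F') (g'1 : forall a b, Ck_on 1 V (fun u => g' u a b))
  (FT : forall u, U u -> F u = F' (T u))
  (gT : forall u, U u -> g u = coord_jac T u *m g' (T u) *m (coord_jac T u)^T)
  (gU : forall u, U u -> g u \in unitmx) (gU' : forall u, V u -> g' u \in unitmx)
  (gS' : forall u, V u -> (g' u)^T = g' u).
Variable u : 'rV[R]_n.
Hypothesis Uu : U u.

Let J := coord_jac T.

Let nearU : \forall z \near u, U z. Proof. exact: open_nbhs_nbhs. Qed.

(** Invertibility comes from the metric: [J u] is a square factor of the invertible matrix [g u]. *)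
Lemma coord_jac_unit : J u \in unitmx.
Proof.
have := gU Uu; rewrite gT// unitmx_mul => /andP[+ _].
by rewrite unitmx_mul => /andP[].
Qed.

Let Td z : U z -> mx_differentiable T z.
Proof.
move=> Uz i b; rewrite ord1; exact: Ck1_differentiable (Ck_onW (T2 b)) Uz.
Qed.

Lemma gradient_row_change z : U z ->
  gradient_row F z = gradient_row F' (T z) *m (J z)^T.
Proof.
move=> Uz; rewrite -gradient_row_comp; last 2 first.
- exact: Td.
- exact: Ck1_differentiable (Ck_onW F'2) (TU Uz).
apply/rowP => a; rewrite !mxE; apply: near_eq_derive.
have : nbhs z U by exact: open_nbhs_nbhs.
by apply: filterS => y /FT.
Qed.

(** Both sides are compared after multiplication by the invertible [g' (T u) *m (J u)^T]. This turns
    them into rows of partial derivatives, for which the law is the chain rule. *)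
Lemma coord_grad_change : coord_grad F g u *m J u = coord_grad F' g' (T u).
Proof.
have JU := coord_jac_unit; have g'U := gU' (TU Uu).
have JTU : (J u)^T \in unitmx by rewrite unitmx_tr.
suff E : coord_grad F g u *m J u *m g' (T u) *m (J u)^T =
    coord_grad F' g' (T u) *m g' (T u) *m (J u)^T.
  rewrite -[LHS](mulmxK g'U) -[LHS in LHS *m _](mulmxK JTU) E.
  by rewrite (mulmxK JTU) (mulmxK g'U).
have -> : coord_grad F g u *m J u *m g' (T u) *m (J u)^T =
    coord_grad F g u *m g u by rewrite gT// !mulmxA.
rewrite (coord_gradK F gU Uu) gradient_row_change//; congr (_ *m _).
by rewrite /coord_grad mulmxKV.
Qed.

Lemma mx_derive_jac_sym v w : v *m mx_derive w J u = w *m mx_derive v J u.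
Proof.
have E x z : x *m mx_derive z J u =
    \row_c \sum_b \sum_a x 0 b * z 0 a * partial a (partial b (fun y => T y 0 c)) u.
  apply/rowP => c; rewrite !mxE; apply: eq_bigr => b _; rewrite !mxE.
  under [in LHS]eq_fun do rewrite mxE.
  rewrite derive_partial; last exact: Ck1_differentiable (Ck_on_partial b (T2 c)) Uu.
  by rewrite mulr_sumr; apply: eq_bigr => a _; rewrite mulrA.
rewrite !E; apply/rowP => c; rewrite !mxE exchange_big/=.
apply: eq_bigr => a _; apply: eq_bigr => b _.
by rewrite (Ck2_partialC _ _ oU (T2 c) Uu) [v _ _ * _]mulrC.
Qed.

(* In the new coordinates the second derivatives of [T] contributed by [F]
   and by [g] cancel, because [v D_X J = X D_v J]. *)
Lemma hess_form_change v :
  hess_form F g u v v = hess_form F' g' (T u) (v *m J u) (v *m J u).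
Proof.
rewrite !hess_form_diag -coord_grad_change.
set X := coord_grad F g u.
have Jd : mx_differentiable J u.
  move=> a b; under eq_fun do rewrite mxE.
  exact: Ck1_differentiable (Ck_on_partial a (T2 b)) Uu.
have JTd := mx_differentiableT Jd.
have dF'd : mx_differentiable (gradient_row F') (T u).
  exact: Ck2_gradient_row F'2 (TU Uu).
have g'd : mx_differentiable g' (T u).
  by move=> a b; exact: Ck1_differentiable (g'1 a b) (TU Uu).
have Tdu := Td Uu.
have EF x : mx_derive x (gradient_row F) u =
    mx_derive (x *m J u) (gradient_row F') (T u) *m (J u)^T +
    gradient_row F' (T u) *m (mx_derive x J u)^T.
  rewrite -mx_derive_comp// -mx_deriveT.
  rewrite -(mx_deriveM _ (mx_differentiable_comp Tdu dF'd) JTd).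
  by apply: mx_derive_near; apply: filterS nearU => z /gradient_row_change.
have Eg x : mx_derive x g u =
    mx_derive x J u *m g' (T u) *m (J u)^T +
    J u *m mx_derive (x *m J u) g' (T u) *m (J u)^T +
    J u *m g' (T u) *m (mx_derive x J u)^T.
  rewrite -mx_derive_comp// -mx_deriveT -mulmxDl.
  have g'Td := mx_differentiable_comp Tdu g'd.
  rewrite -(mx_deriveM _ Jd g'Td) -(mx_deriveM _ (mx_differentiableM Jd g'Td) JTd).
  by apply: mx_derive_near; apply: filterS nearU => z /gT.
have Xg : X *m J u *m g' (T u) = gradient_row F' (T u).
  rewrite coord_grad_change /coord_grad mulmxKV//; exact: gU' (TU Uu).
(* [b] and [c] carry the derivatives of [J]; [a], [d] and [e] are the terms of the form in the new
   coordinates. *)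
have cancel (a b c d e : R) : a + b + 2^-1 * (c + d + c) - (c + e + b) =
    a + 2^-1 * d - e by field.
apply: etrans (cancel _ ((gradient_row F' (T u) *m (v *m mx_derive v J u)^T) 0 0)
  ((v *m mx_derive X J u *m g' (T u) *m (v *m J u)^T) 0 0) _ _).
have E00 (A B : 'M[R]_1) : (A + B) 0 0 = A 0 0 + B 0 0 by rewrite mxE.
congr (_ + _ * _ - _).
- by rewrite EF mulmxDl E00 !trmx_mul !mulmxA.
- rewrite Eg !mulmxDr !mulmxDl !E00; congr (_ + _ + _).
  + by rewrite trmx_mul !mulmxA.
  + by rewrite trmx_mul !mulmxA.
  + rewrite -trmx11 !trmx_mul !trmxK gS'; last exact: TU.
    by rewrite !mulmxA.
- rewrite Eg !mulmxDr !mulmxDl !E00; congr (_ + _ + _).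
  + by rewrite trmx_mul !mulmxA (mx_derive_jac_sym v X).
  + by rewrite trmx_mul !mulmxA.
  + by rewrite trmx_mul !mulmxA Xg.
Qed.

End ChangeOfCoordinates.
End HessianForm.

(** * Least eigenvalue and Rayleigh quotient *)

Section Rayleigh.
Context {R : realType} {n : nat}.
Implicit Types (v w : 'rV[R]_n) (S G : 'M[R]_n).

Definition qform S v : R := (v *m S *m v^T) 0 0.

Lemma qformZ S (k : R) v : qform S (k *: v) = k ^+ 2 * qform S v.
Proof. by rewrite /qform linearZ/= -scalemxAr -!scalemxAl scalerA mxE expr2. Qed.

Lemma qform0 S : qform S 0 = 0.
Proof. by rewrite /qform !mul0mx mxE. Qed.

Lemma qformDZ S (t : R) v w : S^T = S ->
  qform S (v + t *: w) =
  qform S v + 2 * t * (v *m S *m w^T) 0 0 + t ^+ 2 * qform S w.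
Proof.
move=> SS; rewrite /qform linearD linearZ/= !mulmxDr !mulmxDl.
rewrite -!scalemxAr -!scalemxAl scalerA.
have E00 (A B : 'M[R]_1) : (A + B) 0 0 = A 0 0 + B 0 0 by rewrite mxE.
have Z00 k (A : 'M[R]_1) : (k *: A) 0 0 = k * A 0 0 by rewrite mxE.
by rewrite !E00 !Z00 (form_sym w v SS); ring.
Qed.

Lemma continuous_qform S : continuous (qform S).
Proof.
move=> v; apply: differentiable_continuous.
have idd : mx_differentiable (@id 'rV[R]_n) v.
  by move=> i j; exact: differentiable_coord.
have := mx_differentiableM (mx_differentiableM idd (mx_differentiable_cst S v))
  (mx_differentiableT idd).
exact.
Qed.

(* The quotient is homogeneous of degree 0, so the unit sphere of the sup norm
   can replace that of [G]. *)
Lemma rayleigh_min S G v : (forall w, w != 0 -> 0 < qform G w) -> v != 0 ->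
  exists2 w, w != 0 & forall z, qform S w / qform G w * qform G z <= qform S z.
Proof.
move=> Gpos v0; pose B := [set w : 'rV[R]_n | `|w| = 1].
pose q w := qform S w / qform G w.
have normB w : w != 0 -> B (`|w|^-1 *: w).
  by move=> w0; rewrite /B/= normrZ normfV normr_id mulVf// normr_eq0.
have Bn0 w : B w -> w != 0.
  by apply: contraPneq => -> /=; rewrite /B/= normr0 => /eqP; rewrite eq_sym oner_eq0.
have Bc : compact B.
  apply: bounded_closed_compact.
    exists 1; split; first exact: num_real.
    by move=> x x1 w; rewrite /B /= => ->; exact: ltW.
  have -> : B = Num.norm @^-1` [set 1] by [].
  apply: closed_comp; last exact: closed_eq.
  by move=> w _; exact: norm_continuous.
have qc : {within B, continuous q}.
  apply: continuous_in_subspaceT => w; rewrite inE => /Bn0 w0.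
  have Gw : qform G w != 0 by rewrite gt_eqF// Gpos.
  exact: (cvgM (@continuous_qform S w) (cvgV Gw (@continuous_qform G w))).
have [w] := EVT_min_rV (ex_intro _ _ (normB _ v0)) Bc qc.
rewrite inE => wB wmin; exists w; first exact: Bn0.
move=> z; have [->|z0] := eqVneq z 0; first by rewrite !qform0 mulr0.
have := wmin (`|z|^-1 *: z); rewrite inE => /(_ (normB _ z0)).
have -> : q (`|z|^-1 *: z) = qform S z / qform G z.
  rewrite /q !qformZ -mulf_div divff ?mul1r//.
  by rewrite expf_neq0// invr_eq0 normr_eq0.
by rewrite ler_pdivlMr//; exact: Gpos.
Qed.

(** The polynomial [qform S (w + t *: z)] in [t] is nonnegative and vanishes at 0, so its linear
    coefficient, which pairs [w *m S] with [z], is zero. *)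
Lemma psd_kernel S w : S^T = S -> (forall z, 0 <= qform S z) -> qform S w = 0 ->
  w *m S = 0.
Proof.
move=> SS Sp w0.
suff orth (z : 'rV[R]_n) : (w *m S *m z^T) 0 0 = 0.
  apply/rowP => a; rewrite [RHS]mxE -(orth (delta_mx 0 a)).
  by rewrite trmx_delta -colE [RHS]mxE.
set c := (w *m S *m z^T) 0 0; apply/eqP; rewrite -sqrf_eq0 eq_le sqr_ge0 andbT.
have P (t : R) : 0 <= 2 * t * c + t ^+ 2 * qform S z.
  by have := Sp (w + t *: z); rewrite qformDZ// w0 add0r.
have q0 := Sp z; set q := qform S z in P q0.
have q1 : 0 < 1 + q by rewrite ltr_wpDr.
(* The minimizer would be [- c / q]; adding 1 keeps the denominator positive when [q = 0], and the
   value is still a negative multiple of [c ^+ 2]. *)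
have := P (- c / (1 + q)); rewrite (_ : _ + _ = - (2 + q) / (1 + q) ^+ 2 * c ^+ 2).
  rewrite mulNr mulNr oppr_ge0 pmulr_rle0// divr_gt0// ?exprn_gt0//.
  by rewrite ltr_wpDr.
by field; rewrite gt_eqF.
Qed.

(** If [a] is the minimal quotient, attained at [w], then [K *m G - a *: G] is positive semidefinite
    and its form vanishes at [w]. Hence [w] lies in its kernel, which makes [a] an eigenvalue of
    [K]. *)
Lemma inf_eigenvalue_le (K G : 'M[R]_n) v : (K *m G)^T = K *m G -> G^T = G ->
  G \in unitmx -> (forall w, w != 0 -> 0 < qform G w) ->
  inf [set a | eigenvalue K a] * qform G v <= qform (K *m G) v.
Proof.
move=> KGS GS GU Gpos.
(* This case includes [n = 0], where there is no eigenvalue and the infimum is a default value. *)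
have [->|v0] := eqVneq v 0; first by rewrite !qform0 mulr0.
have [w w0 wmin] := rayleigh_min (K *m G) Gpos v0.
set a := qform _ w / _ in wmin.
have Gw := Gpos _ w0.
have Ka : eigenvalue K a.
  apply/eigenvalueP; exists w => //.
  have : w *m (K *m G - a *: G) = 0.
    have E z : qform (K *m G - a *: G) z = qform (K *m G) z - a * qform G z.
      by rewrite /qform mulmxBr mulmxBl -scalemxAr -scalemxAl !mxE.
    apply: psd_kernel.
    - by rewrite linearB linearZ/= KGS GS.
    - by move=> z; rewrite E subr_ge0.
    - by rewrite E /a divfK ?subrr// gt_eqF.
  rewrite mulmxBr mulmxA -scalemxAr => /subr0_eq E.
  by apply: (can_inj (mulmxK GU)); rewrite /= E -scalemxAl.
apply: (le_trans _ (wmin v)); apply: ler_wpM2r; first exact/ltW/Gpos.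
(* The infimum lies below its members only if the set is bounded below: every eigenvalue is a
   Rayleigh quotient, so [a] is a lower bound. *)
apply: ge_inf => //; exists a => b /eigenvalueP[z zK z0].
have E : qform (K *m G) z = b * qform G z.
  by rewrite /qform mulmxA zK -!scalemxAl mxE.
by have := wmin z; rewrite E ler_pM2r//; exact: Gpos.
Qed.

End Rayleigh.

(** * Entrywise limits of matrix sequences *)

Section EntrywiseLimits.
Context {R : realType}.

Definition mx_cvg p q (A : nat -> 'M[R]_(p, q)) (L : 'M[R]_(p, q)) : Prop :=
  forall i j, A k i j @[k --> \oo] --> L i j.

Lemma mx_cvgM p q r (A : nat -> 'M[R]_(p, q)) (B : nat -> 'M[R]_(q, r)) L L' :
  mx_cvg A L -> mx_cvg B L' -> mx_cvg (fun k => A k *m B k) (L *m L').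
Proof.
move=> AL BL i j; rewrite mxE; under eq_cvg do rewrite mxE.
by apply: cvg_sumr => l _; apply: cvgM; [exact: AL|exact: BL].
Qed.

Lemma mx_cvgD p q (A B : nat -> 'M[R]_(p, q)) L L' :
  mx_cvg A L -> mx_cvg B L' -> mx_cvg (fun k => A k + B k) (L + L').
Proof.
move=> AL BL i j; rewrite mxE; under eq_cvg do rewrite mxE.
by apply: cvgD; [exact: AL|exact: BL].
Qed.

Lemma mx_cvgN p q (A : nat -> 'M[R]_(p, q)) L :
  mx_cvg A L -> mx_cvg (fun k => - A k) (- L).
Proof.
move=> AL i j; rewrite mxE; under eq_cvg do rewrite mxE.
by apply: cvgN; exact: AL.
Qed.

Lemma mx_cvgB p q (A B : nat -> 'M[R]_(p, q)) L L' :
  mx_cvg A L -> mx_cvg B L' -> mx_cvg (fun k => A k - B k) (L - L').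
Proof. by move=> AL BL; apply: mx_cvgD => //; exact: mx_cvgN. Qed.

Lemma mx_cvgT p q (A : nat -> 'M[R]_(p, q)) L :
  mx_cvg A L -> mx_cvg (fun k => (A k)^T) L^T.
Proof. by move=> AL i j; rewrite mxE; under eq_cvg do rewrite mxE; exact: AL. Qed.

Lemma mx_cvg_cst p q (C : 'M[R]_(p, q)) : mx_cvg (fun=> C) C.
Proof. by move=> i j; exact: cvg_cst. Qed.

Lemma mx_cvg_near p q (A B : nat -> 'M[R]_(p, q)) L :
  (\forall k \near \oo, A k = B k) -> mx_cvg A L -> mx_cvg B L.
Proof.
move=> AB AL i j; apply: cvg_trans (AL i j); apply: near_eq_cvg.
by apply: filterS AB => k ->.
Qed.

Lemma mx_cvg_unique p q (A : nat -> 'M[R]_(p, q)) L L' :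
  mx_cvg A L -> mx_cvg A L' -> L = L'.
Proof.
by move=> AL AL'; apply/matrixP => i j; exact: (cvg_unique _ (AL i j) (AL' i j)).
Qed.

Variables (n : nat) (u : nat -> 'rV[R]_n) (us : 'rV[R]_n).
Hypothesis uus : u @ \oo --> us.

Lemma mx_cvg_differentiable p q (A : 'rV[R]_n -> 'M[R]_(p, q)) :
  mx_differentiable A us -> mx_cvg (fun k => A (u k)) (A us).
Proof.
move=> Ad i j; apply: (cvg_comp u (fun z => A z i j) uus).
exact: mx_differentiable_continuous.
Qed.

(** The direction moves with the point, so the derivative is expanded in partial derivatives, which
    are continuous at [us]. The expansion is available once [u k] has entered [U]. *)
Lemma mx_cvg_derive p q (U : set 'rV[R]_n) (A : 'rV[R]_n -> 'M[R]_(p, q))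
    (v : nat -> 'rV[R]_n) (vs : 'rV[R]_n) :
  open U -> U us -> (forall i j, Ck_on 1 U (fun z => A z i j)) ->
  mx_cvg v vs ->
  mx_cvg (fun k => mx_derive (v k) A (u k)) (mx_derive vs A us).
Proof.
move=> oU Uus A1 vvs i j.
have D z w : U z -> mx_derive w A z i j =
    \sum_a w 0 a * partial a (fun y => A y i j) z.
  move=> Uz; rewrite mxE derive_partial//.
  exact: Ck1_differentiable (A1 i j) Uz.
rewrite D//.
have Uu : \forall k \near \oo, U (u k).
  by apply: uus; apply: open_nbhs_nbhs.
apply: (@cvg_trans _ ((fun k => \sum_a v k 0 a * partial a (fun y => A y i j) (u k)) @ \oo)).
  by apply: near_eq_cvg; apply: filterS Uu => k /D ->.
apply: cvg_sumr => a _; apply: cvgM; first exact: vvs.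
apply: (cvg_comp u (partial a (fun z => A z i j)) uus).
by have [_ /(_ a)[_ [+ _]]] := A1 i j; apply.
Qed.

End EntrywiseLimits.

Arguments mx_cvg_cst {R p q} C.

(** * Passage to the limit in the Hessian form *)

Section HessianLimit.
Context {R : realType} {n : nat}.
Variables (u : nat -> 'rV[R]_n) (us : 'rV[R]_n).
Hypothesis uus : u @ \oo --> us.
Variables (U : set 'rV[R]_n) (F : 'rV[R]_n -> R) (g : 'rV[R]_n -> 'M[R]_n).
Hypotheses (oU : open U) (Uus : U us) (F2 : Ck_on 2 U F)
  (g1 : forall a b, Ck_on 1 U (fun u => g u a b))
  (gU : forall u, U u -> g u \in unitmx).

Lemma hess_form_cvg (v w : nat -> 'rV[R]_n) (vs ws : 'rV[R]_n) :
  mx_cvg v vs -> mx_cvg w ws ->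
  hess_form F g (u k) (v k) (w k) @[k --> \oo] --> hess_form F g us vs ws.
Proof.
move=> vvs wws.
have dF1 i j : Ck_on 1 U (fun z => gradient_row F z i j).
  rewrite (_ : (fun _ => _) = partial j F); first exact: Ck_on_partial F2.
  by apply/funext => z; rewrite mxE.
have Xd : mx_differentiable (coord_grad F g) us.
  exact: (coord_grad_differentiable oU F2 g1 gU Uus).
have XC := mx_cvg_differentiable uus Xd.
have vT := mx_cvgT vvs; have wT := mx_cvgT wws.
apply: cvgD.
  exact: (mx_cvgM (mx_cvg_derive uus oU Uus dF1 vvs) wT).
apply: cvgMl_tmp; apply: cvgB; first apply: cvgB.
- exact: (mx_cvgM (mx_cvgM vvs (mx_cvg_derive uus oU Uus g1 XC)) wT).
- exact: (mx_cvgM (mx_cvgM XC (mx_cvg_derive uus oU Uus g1 vvs)) wT).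
- exact: (mx_cvgM (mx_cvgM XC (mx_cvg_derive uus oU Uus g1 wws)) vT).
Qed.

End HessianLimit.

(** * First- and second-order limits in a single chart *)

Section CoordinateLimit.
Context {R : realType} {n m : nat}.
Variables (u : nat -> 'rV[R]_n) (us : 'rV[R]_n).
Hypothesis uus : u @ \oo --> us.
Variables (U : set 'rV[R]_n) (F : 'rV[R]_n -> R) (G : 'I_m -> 'rV[R]_n -> R)
  (g : 'rV[R]_n -> 'M[R]_n).
Hypotheses (oU : open U) (Uus : U us) (F2 : Ck_on 2 U F)
  (G2 : forall i, Ck_on 2 U (G i))
  (g1 : forall a b, Ck_on 1 U (fun u => g u a b))
  (gU : forall u, U u -> g u \in unitmx).

Definition constraint_jac z : 'M[R]_(m, n) := \matrix_(i, a) partial a (G i) z.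
Local Notation A := constraint_jac.

Variables (act : pred 'I_m) (y : nat -> 'rV[R]_m).
Hypotheses (G_inact : forall i, ~~ act i -> 0 < G i us)
  (y_ge0 : forall k i, 0 <= y k 0 i)
  (yG : forall i, y k 0 i * G i (u k) @[k --> \oo] --> (0 : R))
  (yP : mx_cvg (fun k => gradient_row F (u k) - y k *m A (u k)) 0)
  (dual : forall k, exists w : 'cV[R]_n,
     forall i, act i -> (A us *m w) i 0 = (i == k)%:R).

Lemma constraint_jac_differentiable : mx_differentiable A us.
Proof.
move=> i a; under eq_fun do rewrite mxE.
exact: (Ck1_differentiable oU (Ck_on_partial a (G2 i)) Uus).
Qed.

Lemma constraint_continuous i : G i (u k) @[k --> \oo] --> G i us.
Proof.
apply: (cvg_comp u (G i) uus).
exact: (Ck_on_continuous (G2 i) Uus).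
Qed.

(** The complementarity product is divided by a constraint value that stays away from 0. *)
Lemma multiplier_inactive i : ~~ act i -> y k 0 i @[k --> \oo] --> (0 : R).
Proof.
move=> ia; have Gi := G_inact ia.
have G0 : \forall k \near \oo, 0 < G i (u k).
  by have /cvgr_gt := constraint_continuous (i := i); apply.
have : y k 0 i * G i (u k) * (G i (u k))^-1 @[k --> \oo] --> 0 * (G i us)^-1.
  apply: cvgM; first exact: yG.
  by apply: cvgV; [rewrite gt_eqF|exact: constraint_continuous].
rewrite mul0r; apply: cvg_trans; apply: near_eq_cvg.
by apply: filterS G0 => k Gk; rewrite mulfK// gt_eqF.
Qed.

(** Projection onto the active indices: all matrices keep their [m] rows, and no submatrix of active
    rows has to be extracted. *)
Let D : 'M[R]_m := diag_mx (\row_i (act i)%:R).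

Let mulD p (C : 'M[R]_(m, p)) i j : (D *m C) i j = (act i)%:R * C i j.
Proof. by rewrite mul_diag_mx !mxE. Qed.

(** A column with inactive index is annihilated by every active row, so [D *m A us *m W] is exactly
    [D]. *)
Let W : 'M[R]_(n, m) := \matrix_(b, k) sval (cid (dual k)) b 0.

Let DAW : D *m A us *m W = D.
Proof.
apply/matrixP => i k; rewrite -mulmxA mulD [RHS]mxE [in RHS]mxE.
case: (boolP (act i)) => ia; last by rewrite mul0r mul0rn.
rewrite mul1r -(svalP (cid (dual k)) i ia) !mxE.
by apply: eq_bigr => b _; rewrite !mxE.
Qed.

(* The identity at [us], hence invertible nearby. *)
Let B z : 'M[R]_m := 1%:M - D + D *m A z *m W.

Let Bus : B us = 1%:M. Proof. by rewrite /B DAW subrK. Qed.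

Let Bd : mx_differentiable B us.
Proof.
apply: mx_differentiableD; first exact: mx_differentiable_cst.
apply: mx_differentiableM; last exact: mx_differentiable_cst.
apply: mx_differentiableM; last exact: constraint_jac_differentiable.
exact: mx_differentiable_cst.
Qed.

Let BU : B us \in unitmx. Proof. by rewrite Bus unitmx1. Qed.

Let Bu : \forall k \near \oo, B (u k) \in unitmx.
Proof. exact: (uus (near_unitmx Bd BU)). Qed.

Let BVcvg : mx_cvg (fun k => invmx (B (u k))) 1%:M.
Proof.
have := mx_cvg_differentiable uus (mx_differentiable_inv Bd BU).
by rewrite Bus invmx1.
Qed.

Let A_cvg : mx_cvg (fun k => A (u k)) (A us).
Proof. exact: (mx_cvg_differentiable uus constraint_jac_differentiable). Qed.

Let F_cvg : mx_cvg (fun k => gradient_row F (u k)) (gradient_row F us).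
Proof. exact: (mx_cvg_differentiable uus (Ck2_gradient_row oU F2 Uus)). Qed.

Let y_inactive : mx_cvg (fun k => y k *m (1%:M - D)) 0.
Proof.
move=> j i; rewrite ord1 (_ : (0 : 'rV[R]_m) 0 i = 0); last by rewrite mxE.
have E k : (y k *m (1%:M - D)) 0 i = if act i then 0 else y k 0 i.
  rewrite mulmxBr mulmx1 mul_mx_diag !mxE.
  by case: (act i); rewrite ?mulr1 ?mulr0 ?subrr ?subr0.
apply: (@cvg_trans _ ((fun k => if act i then 0 else y k 0 i) @ \oo)).
  by apply: near_eq_cvg; near=> k; rewrite E.
by case: (boolP (act i)) => [_|/multiplier_inactive//]; exact: cvg_cst.
Unshelve. all: by end_near. Qed.

(** No bound on [y] is available beforehand. Since [y *m D *m A] is [y *m A] minus an inactive part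
    tending to 0, and [y *m A] is the gradient of [F] minus the residual, [y *m B] converges to [c].
    Multiplying by the inverse of [B], which tends to the identity, isolates [y]. *)
Lemma multiplier_cvg : exists ys : 'rV[R]_m, mx_cvg y ys.
Proof.
pose c := gradient_row F us *m W.
have yB : mx_cvg (fun k => y k *m B (u k)) c.
  have H := mx_cvgD y_inactive (mx_cvgM (mx_cvgB (mx_cvgB F_cvg yP)
    (mx_cvgM y_inactive A_cvg)) (mx_cvg_cst W)).
  rewrite subr0 mul0mx subr0 add0r in H; apply: mx_cvg_near H.
  near=> k; rewrite [RHS]mulmxDr; congr (_ + _).
  rewrite opprB addrCA subrr addr0 !mulmxA; congr (_ *m _).
  by rewrite -mulmxBl mulmxBr mulmx1 opprB addrCA subrr addr0.
have := mx_cvgM yB BVcvg; rewrite mulmx1 => H; exists c; apply: mx_cvg_near H.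
by apply: filterS Bu => k Bk; rewrite mulmxK.
Unshelve. all: by end_near. Qed.

Lemma multiplier_KKT ys : mx_cvg y ys ->
  gradient_row F us = ys *m A us /\
  forall i, 0 <= ys 0 i /\ ys 0 i * G i us = 0.
Proof.
move=> yys; split.
  apply/eqP; rewrite -subr_eq0; apply/eqP.
  exact: (mx_cvg_unique (mx_cvgB F_cvg (mx_cvgM yys A_cvg)) yP).
move=> i; split.
  by apply: (cvgr_to_ge (yys 0 i)); near=> k; exact: y_ge0.
exact: (cvg_unique _ (cvgM (yys 0 i) (constraint_continuous (i := i))) (yG i)).
Unshelve. all: by end_near. Qed.

(** The lower bound is tested on vectors [v k] tending to [xi] that lie exactly in the kernel of the
    active rows at [u k]. The possibly unbounded quotients with active index are then multiplied by
    0. *)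
Lemma second_order_limit ys (xi : 'rV[R]_n) (e : nat -> R) :
  mx_cvg y ys -> e @ \oo --> (0 : R) ->
  (forall i, act i -> (A us *m xi^T) i 0 = 0) ->
  (forall k v, - e k * qform (g (u k)) v <=
     hess_form F g (u k) v v - \sum_i y k 0 i * hess_form (G i) g (u k) v v
     + \sum_i y k 0 i / G i (u k) * ((A (u k) *m v^T) i 0) ^+ 2) ->
  0 <= hess_form F g us xi xi - \sum_i ys 0 i * hess_form (G i) g us xi xi.
Proof.
move=> yys e0 xi_act lbound.
(* Were [D *m A *m W] equal to [B], this would solve [D *m A *m zeta = D *m A *m xi^T]. The two
   differ by [1%:M - D], whose contribution has no active entry. *)
pose zeta k : 'cV[R]_n := W *m invmx (B (u k)) *m (D *m A (u k) *m xi^T).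
pose v k : 'rV[R]_n := xi - (zeta k)^T.
have subE p q (C C' : 'M[R]_(p, q)) i j : (C - C') i j = C i j - C' i j.
  by rewrite !mxE.
have DAxi : D *m A us *m xi^T = 0.
  apply/colP => i; rewrite -mulmxA mulD [RHS]mxE.
  by case: (boolP (act i)) => [/xi_act ->|_]; rewrite ?mulr0 ?mul0r.
have vxi : mx_cvg v xi.
  have H := mx_cvgB (mx_cvg_cst xi) (mx_cvgT (mx_cvgM
    (mx_cvgM (mx_cvg_cst W) BVcvg)
    (mx_cvgM (mx_cvgM (mx_cvg_cst D) A_cvg) (mx_cvg_cst xi^T)))).
  by rewrite DAxi mulmx0 trmx0 subr0 in H.
have v_act : \forall k \near \oo, forall i, act i -> (A (u k) *m (v k)^T) i 0 = 0.
  apply: filterS Bu => k Bk i ia.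
  suff : (D *m A (u k) *m (v k)^T) i 0 = 0 by rewrite -mulmxA mulD ia mul1r.
  suff -> : D *m A (u k) *m (v k)^T = (1%:M - D) *m (D *m A (u k) *m xi^T).
    by rewrite mulmxBl mul1mx subE mulD ia mul1r subrr.
  have DD : (1%:M - D) *m D = 0.
    apply/matrixP => a b; rewrite mulmxBl mul1mx subE mulD !mxE.
    by case: (act a); rewrite ?mul1r ?mul0r ?mul0rn ?subr0 ?subrr.
  (* From [(1%:M - D) *m D = 0] the matrix [B] acts as the identity behind [1%:M - D], and so does
     its inverse. *)
  have DB : (1%:M - D) *m invmx (B (u k)) = 1%:M - D.
    apply: (can_inj (mulmxK Bk)); rewrite /= mulmxKV// /B mulmxDr !mulmxA DD.
    rewrite !mul0mx addr0 mulmxBr mulmx1 -[LHS]subr0; congr (_ - _).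
    by rewrite DD.
  have DAWE : D *m A (u k) *m W = B (u k) - (1%:M - D) by rewrite /B addrC addKr.
  set X := D *m A (u k) *m xi^T.
  have -> : D *m A (u k) *m (v k)^T =
      X - (B (u k) - (1%:M - D)) *m (invmx (B (u k)) *m X).
    by rewrite -DAWE /v linearB/= trmxK mulmxBr /zeta !mulmxA.
  by rewrite mulmxBl mulKVmx// mulmxA DB opprB addrCA subrr addr0.
pose S k := \sum_i y k 0 i / G i (u k) * ((A (u k) *m (v k)^T) i 0) ^+ 2.
have S0 : S k @[k --> \oo] --> (0 : R).
  rewrite -(big1 (I := 'I_m) (idx := 0) (op := +%R) (index_enum _) xpredT (fun=> 0))//.
  apply: cvg_sumr => i _; case: (boolP (act i)) => ia.
    apply: (@cvg_trans _ ((fun=> 0 : R) @ \oo)); last exact: cvg_cst.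
    apply: near_eq_cvg; apply: filterS v_act => k /(_ i ia) ->.
    by rewrite expr0n/= mulr0.
  have Gi := G_inact ia.
  have H : y k 0 i / G i (u k) @[k --> \oo] --> 0 * (G i us)^-1.
    apply: cvgM; first exact: multiplier_inactive.
    by apply: cvgV; [rewrite gt_eqF|exact: constraint_continuous].
  have H2 := mx_cvgM A_cvg (mx_cvgT vxi).
  have := cvgM H (cvgM (H2 i 0) (H2 i 0)); rewrite !mul0r; exact.
have gd : mx_differentiable g us.
  by move=> a b; exact: Ck1_differentiable (g1 a b) Uus.
have Q : - e k * qform (g (u k)) (v k) @[k --> \oo] --> (0 : R).
  have H := mx_cvgM (mx_cvgM vxi (mx_cvg_differentiable uus gd)) (mx_cvgT vxi).
  have := cvgM (cvgN e0) (H 0 0).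
  by rewrite oppr0 mul0r; exact.
pose rhs k := hess_form F g (u k) (v k) (v k)
    - \sum_i y k 0 i * hess_form (G i) g (u k) (v k) (v k) + S k.
have H : rhs k @[k --> \oo] -->
    hess_form F g us xi xi - \sum_i ys 0 i * hess_form (G i) g us xi xi.
  rewrite -[X in _ --> X]addr0; apply: cvgD S0; apply: cvgB.
    exact: (hess_form_cvg uus oU Uus F2 g1 gU vxi vxi).
  apply: cvg_sumr => i _; apply: cvgM; first exact: yys.
  exact: (hess_form_cvg uus oU Uus (G2 i) g1 gU vxi vxi).
have LE := ler_cvg_to Q H.
apply: LE; apply: nearW => k; exact: lbound.
Qed.

End CoordinateLimit.

Arguments image_open {R n s} i : rename.

(** * Transition maps between charts *)

Section Coordinates.
Context {R : realType} {n : nat} {M : smoothManifold R n}.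

Lemma chart_overlap_open (i j : chart M) : open (phi i @` (dom i `&` dom j)).
Proof.
rewrite openE => _ [x [xi xj] <-].
have Ui : nbhs (phi i x) (phi i @` dom i).
  by apply: open_nbhs_nbhs; split; [exact: image_open|exists x].
have Uj : nbhs (phi i x) (psi i @^-1` dom j).
  apply: (psi_continuous (_ : (phi i @` dom i) (phi i x))); first by exists x.
  by rewrite phiK//; apply: open_nbhs_nbhs; split => //; exact: dom_open.
apply: filterS2 Ui Uj => _ [y yi <-] /=; rewrite phiK// => yj.
by exists y.
Qed.

Definition transition (i j : chart M) (u : 'rV[R]_n) : 'rV[R]_n := phi j (psi i u).

Lemma transition_phi (i j : chart M) x : dom i x -> transition i j (phi i x) = phi j x.
Proof. by move=> xi; rewrite /transition phiK. Qed.

Lemma transition_image (i j : chart M) u :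
  (phi i @` (dom i `&` dom j)) u -> (phi j @` dom j) (transition i j u).
Proof. by move=> [x [xi xj] <-]; exists x => //; rewrite transition_phi. Qed.

Lemma jacE (i j : chart M) x : jac i j x = coord_jac (transition i j) (phi i x).
Proof. by []. Qed.

Lemma psi_transition (i j : chart M) u :
  (phi i @` (dom i `&` dom j)) u -> psi j (transition i j u) = psi i u.
Proof. by move=> [x [xi xj] <-]; rewrite transition_phi// !phiK. Qed.

End Coordinates.

Arguments chart_overlap_open {R n M} i j.

(** * Gradient, connection and Hessian read in an arbitrary chart *)

Section RiemannianCoordinates.
Context {R : realType} {n : nat} {M : riemannianManifold R n}.
Implicit Types (i j : chart M) (x : M).

Lemma gram_unit i u : (phi i @` dom i) u -> gram i u \in unitmx.
Proof.
move=> iu; rewrite -row_free_unit -kermx_eq0; apply/negPn/negP => /rowV0Pn[w wK w0].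
have := gram_pos iu w0.
by rewrite (sub_kermxP wK) mul0mx mxE ltxx.
Qed.

Lemma gram_transition i j u : (phi i @` (dom i `&` dom j)) u ->
  gram i u = coord_jac (transition i j) u *m gram j (transition i j u)
             *m (coord_jac (transition i j) u)^T.
Proof.
by move=> [x [xi xj] <-]; rewrite transition_phi// -jacE; exact: gram_compat.
Qed.

Section Function.
Variables (f : M -> R) (f2 : Ck 2 f).

Lemma comp_psi_transition i j u : (phi i @` (dom i `&` dom j)) u ->
  (f \o psi i) u = (f \o psi j) (transition i j u).
Proof. by move=> uij /=; rewrite psi_transition. Qed.

Let overlap_gram_unit i j u : (phi i @` (dom i `&` dom j)) u -> gram i u \in unitmx.
Proof. by move=> [x [xi _] <-]; apply: gram_unit; exists x. Qed.

Lemma jac_unit i j x : dom i x -> dom j x -> jac i j x \in unitmx.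
Proof.
move=> xi xj; have : gram i (phi i x) \in unitmx by apply: gram_unit; exists x.
rewrite (gram_compat xi xj) unitmx_mul => /andP[+ _].
by rewrite unitmx_mul => /andP[].
Qed.

Lemma coord_grad_chart i j x : dom i x -> dom j x ->
  coord_grad (f \o psi i) (gram i) (phi i x) *m jac i j x =
  coord_grad (f \o psi j) (gram j) (phi j x).
Proof.
move=> xi xj; have uij : (phi i @` (dom i `&` dom j)) (phi i x) by exists x.
rewrite -(transition_phi j xi) jacE.
apply: (coord_grad_change (chart_overlap_open i j)
  (image_open j) (@transition_image _ _ _ i j) _ (f2 j)
  (fun u => @comp_psi_transition i j u) (fun u => @gram_transition i j u) (fun u => @overlap_gram_unit i j u)
  (@gram_unit j) uij).
by move=> b; exact: transition_smooth.
Qed.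

Lemma hess_form_chart i j x v : dom i x -> dom j x ->
  hess_form (f \o psi i) (gram i) (phi i x) v v =
  hess_form (f \o psi j) (gram j) (phi j x) (v *m jac i j x) (v *m jac i j x).
Proof.
move=> xi xj; have uij : (phi i @` (dom i `&` dom j)) (phi i x) by exists x.
rewrite -(transition_phi j xi) jacE.
apply: (hess_form_change (chart_overlap_open i j)
  (image_open j) (@transition_image _ _ _ i j) _ (f2 j) _
  (fun u => @comp_psi_transition i j u) (fun u => @gram_transition i j u) (fun u => @overlap_gram_unit i j u)
  (@gram_unit j) (@gram_sym _ _ _ j) uij).
  by move=> b; exact: transition_smooth.
by move=> a b; exact: gram_smooth.
Qed.

Lemma in_chart_grad i x : dom i x ->
  in_chart i x (grad f x) = coord_grad (f \o psi i) (gram i) (phi i x).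
Proof. by move=> xi; rewrite -(coord_grad_chart (chart_atP x) xi). Qed.

End Function.

(** Contraction with the metric cancels the inverse Gram matrix in the Christoffel symbols and
    leaves Koszul's formula for vectors with constant components. *)
Lemma christoffel_form_metric i u v w z : (phi i @` dom i) u ->
  (christoffel_form i u v w *m gram i u *m z^T) 0 0 =
  2^-1 * ((w *m mx_derive v (gram i) u *m z^T) 0 0
    + (v *m mx_derive w (gram i) u *m z^T) 0 0
    - (v *m mx_derive z (gram i) u *m w^T) 0 0).
Proof.
move=> iu; set G := gram i; have Gu := gram_unit iu.
have Gd : mx_differentiable G u.
  move=> a b; apply: (Ck1_differentiable (image_open i) _ iu).
  exact: (gram_smooth i a b 1%N).
(* Twice the Christoffel symbols of the first kind, contracted with [v] and [w]. *)
pose K : 'rV[R]_n := \row_d \sum_a \sum_b v 0 a * w 0 b *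
  (partial a (fun y => G y b d) u + partial b (fun y => G y a d) u
   - partial d (fun y => G y a b) u).
have -> : christoffel_form i u v w = 2^-1 *: (K *m invmx (G u)).
  apply/rowP => c; rewrite !mxE.
  transitivity (\sum_a \sum_b \sum_d 2^-1 * (v 0 a * w 0 b *
   (partial a (fun y => G y b d) u + partial b (fun y => G y a d) u
   - partial d (fun y => G y a b) u) * invmx (G u) d c)).
    apply: eq_bigr => a _; apply: eq_bigr => b _.
    rewrite /christoffel mulr_sumr !mulr_suml; apply: eq_bigr => d _.
    (* [christoffel] contracts the second index of the inverse, the row product the first; symmetry
       of the metric reconciles them. *)
    rewrite -/G (_ : invmx (G u) c d = invmx (G u) d c); first by ring.
    have GS : (G u)^T = G u := gram_sym iu.
    by rewrite -{1}GS -trmx_inv mxE.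
  rewrite mulr_sumr; under [RHS]eq_bigr do rewrite mxE mulr_suml mulr_sumr.
  rewrite [RHS]exchange_big/=; apply: eq_bigr => a _.
  under [RHS]eq_bigr do rewrite mulr_suml mulr_sumr.
  by rewrite [RHS]exchange_big.
rewrite -!scalemxAl mulmxKV// mxE; congr (_ * _).
have D (x y t : 'rV[R]_n) : (y *m mx_derive x G u *m t^T) 0 0 =
    \sum_c \sum_b \sum_a x 0 a * y 0 b * t 0 c * partial a (fun s => G s b c) u.
  rewrite mxE; apply: eq_bigr => c _; rewrite !mxE mulr_suml; apply: eq_bigr => b _.
  rewrite !mxE derive_partial; last exact: Gd.
  by rewrite mulr_sumr mulr_suml; apply: eq_bigr => a _; ring.
apply: etrans (esym (f_equal3 (fun a b c => a + b - c) (D v w z) (D w v z) (D z v w))).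
have -> : \sum_c \sum_b \sum_a z 0 a * v 0 b * w 0 c * partial a (fun s => G s b c) u
  = \sum_d \sum_a \sum_b v 0 a * w 0 b * z 0 d * partial d (fun s => G s a b) u.
  rewrite exchange_big/=; under eq_bigr do rewrite exchange_big/=.
  rewrite exchange_big/=; apply: eq_bigr => d _; apply: eq_bigr => a _.
  by apply: eq_bigr => b _; ring.
have -> : \sum_c \sum_b \sum_a v 0 a * w 0 b * z 0 c * partial a (fun s => G s b c) u
  = \sum_d \sum_a \sum_b v 0 a * w 0 b * z 0 d * partial a (fun s => G s b d) u.
  by apply: eq_bigr => d _; rewrite exchange_big.
rewrite mxE -big_split -sumrB/=; apply: eq_bigr => d _; rewrite !mxE mulr_suml.
rewrite -big_split -sumrB/=; apply: eq_bigr => a _; rewrite mulr_suml.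
rewrite -big_split -sumrB/=; apply: eq_bigr => b _.
by ring.
Qed.

Lemma nabla_linear (X : forall x : M, tangent M x) x :
  linear (nabla X (x := x) : 'rV[R]_n -> 'rV[R]_n).
Proof.
move=> k v w; rewrite /nabla; apply/rowP => c; rewrite !mxE mulrDr.
rewrite addrACA; congr (_ + _).
  rewrite mulr_sumr -big_split/=; apply: eq_bigr => a _; rewrite !mxE; ring.
rewrite mulr_sumr -big_split/=; apply: eq_bigr => a _.
rewrite mulr_sumr -big_split/=; apply: eq_bigr => b _; rewrite !mxE; ring.
Qed.

(** The derivative of the gradient components, lowered by [derive_coord_grad], and the Koszul
    expression add up to [hess_form], because [X u] and [v] may be exchanged in the derivative of
    the metric along [w]. *)
Lemma metric_hess f x v w : Ck 2 f ->
  metric x (hess f x v) w =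
  hess_form (f \o psi (chart_at x)) (gram (chart_at x)) (phi (chart_at x) x) v w.
Proof.
move=> f2; set i := chart_at x; set u := phi i x.
have xi : dom i x by exact: chart_atP.
have iu : (phi i @` dom i) u by exists x.
have nU : \forall z \near u, (phi i @` dom i) z.
  by apply: open_nbhs_nbhs; split => //; exact: image_open.
have g1 a b : Ck_on 1 (phi i @` dom i) (fun z => gram i z a b) by exact: gram_smooth.
pose X := coord_grad (f \o psi i) (gram i).
have Xd : mx_differentiable X u.
  exact: (coord_grad_differentiable (image_open i) (f2 i) g1 (@gram_unit i) iu).
have -> : hess f x v = mx_derive v X u + christoffel_form i u v (X u) :> 'rV[R]_n.
  rewrite /hess /nabla; congr (_ + _).
  apply/rowP => c; rewrite !mxE derive_partial; last exact: Xd.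
  (* [nabla] reads the gradients at nearby points, each stored in its own preferred chart, back in
     the chart at [x]. They equal [coord_grad] on the image of that chart only, which suffices for a
     derivative at [u]. *)
  apply: eq_bigr => a _; congr (_ * _); apply: near_eq_derive.
  apply: filterS nU => _ [y yi <-]; rewrite phiK// in_chart_grad//.
rewrite /metric -/i -/u mulmxDl mulmxDl.
have E00 (A B : 'M[R]_1) : (A + B) 0 0 = A 0 0 + B 0 0 by rewrite mxE.
rewrite E00 christoffel_form_metric//.
have -> := derive_coord_grad (image_open i) (f2 i) g1 (@gram_unit i) iu v.
rewrite -/X -/u mulmxBl.
have B00 (A B : 'M[R]_1) : (A - B) 0 0 = A 0 0 - B 0 0 by rewrite !mxE.
rewrite B00 /hess_form -/X.
rewrite (form_sym v (X u) (mx_derive_sym (image_open i) (@gram_sym _ _ _ i) iu w)).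
have aux (a b c d : R) : a - b + 2^-1 * (b + c - d) = a + 2^-1 * (c - b - d) by field.
exact: aux.
Qed.

Lemma metric_in_chart j x v w : dom j x ->
  metric x v w =
  (in_chart j x v *m gram j (phi j x) *m (in_chart j x w)^T) 0 0.
Proof.
move=> xj; rewrite /metric (gram_compat (chart_atP x) xj) /in_chart.
by rewrite trmx_mul !mulmxA.
Qed.

Lemma metric_grad_in_chart j f x v : Ck 2 f -> dom j x ->
  metric x (grad f x) v =
  (gradient_row (f \o psi j) (phi j x) *m (in_chart j x v)^T) 0 0.
Proof.
move=> f2 xj; have ju : (phi j @` dom j) (phi j x) by exists x.
rewrite (metric_in_chart _ _ xj) in_chart_grad//.
by rewrite (coord_gradK _ (@gram_unit j) ju).
Qed.

Lemma metric_hess_in_chart j f x v : Ck 2 f -> dom j x ->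
  metric x (hess f x v) v =
  hess_form (f \o psi j) (gram j) (phi j x) (in_chart j x v) (in_chart j x v).
Proof.
by move=> f2 xj; rewrite metric_hess// (hess_form_chart f2 _ (chart_atP x) xj).
Qed.

Lemma metric_hess_sym f x v w : Ck 2 f ->
  metric x (hess f x v) w = metric x (hess f x w) v.
Proof.
move=> f2; have xi := chart_atP x.
rewrite !metric_hess// (hess_form_sym (image_open (chart_at x)) (f2 _)
  (@gram_sym _ _ _ (chart_at x)))//.
Qed.

End RiemannianCoordinates.

(** The dual vectors represent the coordinate functionals of the free family; for [k] outside [A]
    the zero vector serves. *)
Lemma free_dual (R : realType) (n m : nat) (A : {set 'I_m}) (X : 'I_m -> 'rV[R]_n) :
  free [seq X i | i in A] ->
  forall k, exists w : 'cV[R]_n, forall i, i \in A -> (X i *m w) 0 0 = (i == k)%:R.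
Proof.
move=> Xf k; have [kA|kA] := boolP (k \in A); last first.
  exists 0 => i iA; rewrite mulmx0 mxE.
  by case: eqVneq iA => // ->; rewrite (negbTE kA).
pose XA := image_tuple X (mem A); pose r := enum_rank_in kA.
(* A linear form on row vectors is the column of its values on the standard basis. *)
exists (\col_b coord XA (r k) (delta_mx 0 b)) => i iA.
transitivity (coord XA (r k) (X i)).
  rewrite mxE [in RHS](row_sum_delta (X i)) linear_sum.
  by apply: eq_bigr => b _; rewrite !mxE linearZ.
have Xi : X i = XA`_(r i).
  by rewrite /= nth_image enum_rankK_in.
rewrite Xi coord_free//; congr (nat_of_bool _)%:R.
apply/eqP/eqP => [E|->//].
exact: etrans (esym (enum_rankK_in kA iA)) (etrans (congr1 enum_val E) (enum_rankK_in kA kA)).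
Qed.

(** Continuity at 0 is only from the right, which positivity of [mu] makes sufficient. *)
Lemma forcing_cvg0 (R : realType) (h : R -> R) (mu : nat -> R) :
  forcing_function h -> (forall k, 0 < mu k) -> mu @ \oo --> (0 : R) ->
  h (mu k) @[k --> \oo] --> (0 : R).
Proof.
move=> [hc _ h0] mu_pos mu0.
have h_at0 : h z @[z --> within [set t | 0 <= t] (nbhs (0 : R))] --> (0 : R).
  rewrite -[X in _ --> X]((h0 0 (lexx 0)).2 erefl).
  by move/subspace_continuousP : hc; apply; rewrite /= lexx.
apply: (cvg_comp mu h _ h_at0) => P nP.
have H : \forall k \near \oo, 0 <= mu k -> P (mu k) := mu0 _ nP.
have : \forall k \near \oo, P (mu k).
  by apply: filterS H => k; apply; exact: ltW.
exact.
Qed.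

(** * Cauchy-Schwarz, and the operator H(w) as a self-adjoint map *)

Section Metric.
Context {R : realType} {n : nat} {M : riemannianManifold R n} {m : nat}.
Implicit Types (x : M).

Lemma metricB_sum x (a : tangent M x) (c : 'I_m -> R) (b : 'I_m -> tangent M x) w :
  metric x ((a : 'rV[R]_n) - \sum_i c i *: (b i : 'rV[R]_n)) w =
  metric x a w - \sum_i c i * metric x (b i) w.
Proof.
rewrite /metric mulmxBl mulmxBl mulmx_suml mulmx_suml !mxE summxE; congr (_ - _).
by apply: eq_bigr => i _; rewrite -!scalemxAl mxE.
Qed.

Lemma metricD_sum x (a : tangent M x) (c : 'I_m -> R) (b : 'I_m -> tangent M x) w :
  metric x ((a : 'rV[R]_n) + \sum_i c i *: (b i : 'rV[R]_n)) w =
  metric x a w + \sum_i c i * metric x (b i) w.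
Proof.
rewrite /metric mulmxDl mulmxDl mulmx_suml mulmx_suml !mxE summxE; congr (_ + _).
by apply: eq_bigr => i _; rewrite -!scalemxAl mxE.
Qed.

Lemma metric_pos x v : v != 0 :> 'rV[R]_n -> 0 < metric x v v.
Proof. by apply: gram_pos; exists x => //; exact: chart_atP. Qed.

Lemma metric_ge0 x v : 0 <= metric x v v.
Proof.
have [->|/metric_pos/ltW//] := eqVneq (v : 'rV[R]_n) 0.
by rewrite /metric !mul0mx mxE.
Qed.

Lemma metric_cauchy_schwarz x v w : `|metric x v w| <= tnorm x v * tnorm x w.
Proof.
rewrite -(@ler_pXn2r _ 2) ?nnegrE// ?mulr_ge0 ?sqrtr_ge0//.
rewrite exprMn !sqr_sqrtr ?metric_ge0// real_normK ?num_real//.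
have [->|w0] := eqVneq (w : 'rV[R]_n) 0.
  by rewrite /metric trmx0 !mulmx0 [(0 : 'M[R]_1) _ _]mxE expr0n/= mulr0.
have ww := @metric_pos x w w0.
set G := gram (chart_at x) (phi (chart_at x) x).
have GS : G^T = G by apply: gram_sym; exists x => //; exact: chart_atP.
have PS (t : R) : 0 <= metric x v v + 2 * t * metric x v w + t ^+ 2 * metric x w w.
  have := @metric_ge0 x ((v : 'rV[R]_n) + t *: (w : 'rV[R]_n)).
  by rewrite [X in 0 <= X -> _](qformDZ t v w GS).
(* The minimizer of the quadratic polynomial [PS], well defined since [w] is nonzero. *)
move: (PS (- metric x v w / metric x w w)) ww.
move: (metric x v v) (metric x v w) (metric x w w) => p q c H c0.
rewrite -subr_ge0 -(pmulr_lge0 (x := c^-1)) ?invr_gt0//.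
by rewrite (_ : _ * _ = p + 2 * (- q / c) * q + (- q / c) ^+ 2 * c)//; field; rewrite gt_eqF.
Qed.

Section Constraints.
Variables (f : M -> R) (g : 'I_m -> M -> R).
Hypotheses (f2 : Ck 2 f) (g2 : forall i, Ck 2 (g i)).

Lemma condensed_hess_linear x y :
  linear (condensed_hess f g y (x := x) : 'rV[R]_n -> 'rV[R]_n).
Proof.
move=> k v w; rewrite /condensed_hess /hessL /hess !nabla_linear.
have -> : \sum_i y 0 i *: (nabla (grad (g i)) (k *: v + w : tangent M x) : 'rV[R]_n) =
    k *: (\sum_i y 0 i *: (nabla (grad (g i)) (v : tangent M x) : 'rV[R]_n)) +
    \sum_i y 0 i *: (nabla (grad (g i)) (w : tangent M x) : 'rV[R]_n).
  rewrite scaler_sumr -big_split/=; apply: eq_bigr => i _.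
  by rewrite nabla_linear scalerDr !scalerA mulrC.
have -> : \sum_i (y 0 i / g i x * metric x (grad (g i) x) (k *: v + w)) *: (grad (g i) x : 'rV[R]_n) =
    k *: (\sum_i (y 0 i / g i x * metric x (grad (g i) x) v) *: (grad (g i) x : 'rV[R]_n)) +
    \sum_i (y 0 i / g i x * metric x (grad (g i) x) w) *: (grad (g i) x : 'rV[R]_n).
  rewrite scaler_sumr -big_split/=; apply: eq_bigr => i _.
  rewrite scalerA -scalerDl; congr (_ *: _).
  by rewrite /metric linearD linearZ/= mulmxDr -scalemxAr !mxE; ring.
rewrite !scalerDr scalerN opprD.
by rewrite [X in X + _ = _]addrACA [LHS]addrACA.
Qed.

Lemma metric_condensed_hess x y (v w : tangent M x) :
  metric x (condensed_hess f g y v) w =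
  metric x (hess f x v) w - \sum_i y 0 i * metric x (hess (g i) x v) w +
  \sum_i y 0 i / g i x * metric x (grad (g i) x) v * metric x (grad (g i) x) w.
Proof. by rewrite /condensed_hess metricD_sum metricB_sum. Qed.

Lemma condensed_hess_sym x y (v w : tangent M x) :
  metric x (condensed_hess f g y v) w = metric x (condensed_hess f g y w) v.
Proof.
apply: etrans (metric_condensed_hess y v w) _.
apply: etrans _ (esym (metric_condensed_hess y w v)).
apply: (f_equal2 +%R); first apply: (f_equal2 (fun a b => a - b)).
- exact: metric_hess_sym.
- apply: eq_bigr => i _; apply: (f_equal ( *%R (y 0 i))).
  exact: (metric_hess_sym _ _ (g2 i)).
- apply: eq_bigr => i _; exact: mulrAC.
Qed.

(** Self-adjointness for the metric says that [K *m G] is symmetric, with [K] the matrix of H(w) and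
    [G] the Gram matrix in the preferred chart; this is the setting of the Rayleigh bound. *)
Lemma lambda_min_condensed_hess x y (v : tangent M x) :
  lambda_min x (condensed_hess f g y) * metric x v v <=
  metric x (condensed_hess f g y v) v.
Proof.
have ux : (phi (chart_at x) @` dom (chart_at x)) (phi (chart_at x) x).
  by exists x => //; exact: chart_atP.
pose H : {linear 'rV[R]_n -> 'rV[R]_n} := HB.pack
  (condensed_hess f g y (x := x) : 'rV[R]_n -> 'rV[R]_n)
  (GRing.isLinear.Build _ _ _ _ _ (@condensed_hess_linear x y)).
pose K : 'M[R]_n := lin1_mx H; set G := gram (chart_at x) (phi (chart_at x) x).
have KE w : w *m K = condensed_hess f g y (w : tangent M x) by rewrite mul_rV_lin1.
have KG z w : (z *m (K *m G) *m w^T) 0 0 =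
    metric x (condensed_hess f g y (z : tangent M x)) w.
  by rewrite mulmxA KE.
have := @inf_eigenvalue_le _ _ K G v; rewrite /qform KG; apply.
- apply/matrixP => a b; rewrite mxE.
  have E c d : (K *m G) c d = metric x (condensed_hess f g y (delta_mx 0 c : tangent M x)) (delta_mx 0 d).
    by rewrite -KG -rowE trmx_delta -colE !mxE.
  exact: etrans (E b a) (etrans (condensed_hess_sym _ _ _) (esym (E a b))).
- exact: gram_sym.
- exact: gram_unit.
- by move=> w w0; exact: gram_pos.
Qed.

End Constraints.

End Metric.

(** * The residual and the form of H(w) in a fixed chart *)

Section ChartForms.
Context {R : realType} {n : nat} {M : riemannianManifold R n} {m : nat}.
Variables (f : M -> R) (g : 'I_m -> M -> R).
Hypotheses (f2 : Ck 2 f) (g2 : forall i, Ck 2 (g i)).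
Variables (j : chart M) (x : M) (xj : dom j x).

Let A := constraint_jac (fun i => g i \o psi j).

Lemma constraint_jacM p (C : 'M[R]_(n, p)) u i k :
  (A u *m C) i k = (gradient_row (g i \o psi j) u *m C) 0 k.
Proof. by rewrite !mxE; apply: eq_bigr => a _; rewrite !mxE. Qed.

Lemma metric_gradL_in_chart y (v : tangent M x) :
  metric x (gradL f g x y) v =
  ((gradient_row (f \o psi j) (phi j x) - y *m A (phi j x)) *m (in_chart j x v)^T) 0 0.
Proof.
apply: etrans (metricB_sum _ _ _ _) _.
rewrite mulmxBl [RHS]mxE [(- _ : 'M[R]_1) 0 0]mxE -mulmxA.
apply: (f_equal2 (fun a b => a - b)).
  exact: (metric_grad_in_chart _ f2 xj).
rewrite mxE; apply: eq_bigr => i _; apply: (f_equal ( *%R (y 0 i))).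
apply: etrans (metric_grad_in_chart _ (g2 i) xj) _.
by rewrite constraint_jacM.
Qed.

Lemma condensed_hess_in_chart y (v : tangent M x) :
  metric x (condensed_hess f g y v) v =
  hess_form (f \o psi j) (gram j) (phi j x) (in_chart j x v) (in_chart j x v)
  - \sum_i y 0 i * hess_form (g i \o psi j) (gram j) (phi j x)
      (in_chart j x v) (in_chart j x v)
  + \sum_i y 0 i / g i x * ((A (phi j x) *m (in_chart j x v)^T) i 0) ^+ 2.
Proof.
apply: etrans (metric_condensed_hess _ _ _ _ _) _.
apply: (f_equal2 +%R); first apply: (f_equal2 (fun a b => a - b)).
- exact: (metric_hess_in_chart _ f2 xj).
- apply: eq_bigr => i _; apply: (f_equal ( *%R (y 0 i))).
  exact: (metric_hess_in_chart _ (g2 i) xj).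
- apply: eq_bigr => i _; rewrite constraint_jacM.
  by rewrite -(metric_grad_in_chart _ (g2 i) xj) expr2 mulrA.
Qed.

Lemma in_chart_surj (xi : 'rV[R]_n) : exists v : tangent M x, in_chart j x v = xi.
Proof.
exists (xi *m invmx (jac (chart_at x) j x)).
by rewrite /in_chart mulmxKV//; exact: (jac_unit (chart_atP x) xj).
Qed.

End ChartForms.

(** The index [(s k).+1] fits the outer iteration, where [mu k] controls the iterate of index
    [k.+1]. Monotonicity of [s] is not asked for: [k <= s k] already sends [s] to infinity. *)
Lemma cluster_chart_subsequence (R : realType) (n : nat) (M : smoothManifold R n)
    (x : nat -> M) (xs : M) : cluster (x @ \oo) xs ->
  exists s : nat -> nat,
  [/\ forall k, (k <= s k)%N,
      forall k, dom (chart_at xs) (x (s k).+1),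
      phi (chart_at xs) (x (s k).+1) @[k --> \oo] --> phi (chart_at xs) xs &
      x (s k).+1 @[k --> \oo] --> xs].
Proof.
move=> xs_acc; set j := chart_at xs; have xsj : dom j xs by exact: chart_atP.
pose B k := dom j `&` phi j @^-1` ball (phi j xs) (k.+1%:R^-1 : R).
have B_nbhs k : nbhs xs (B k).
  apply: filterI; first by apply: open_nbhs_nbhs; split; [exact: dom_open|].
  by apply: (phi_continuous xsj); apply: nbhsx_ballx; rewrite invr_gt0.
have next k : exists i, (k <= i)%N /\ B k (x i.+1).
  (* The tail consists of indices above [k], so the one found is a successor [i.+1] with
     [k <= i]. *)
  have [] := xs_acc (x @` [set i | (k < i)%N]) (B k) _ (B_nbhs k).
    exists k.+1 => // i /= ki; by exists i.
  by move=> _ [[[|i]//= ki <-] Bi]; exists i.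
have [s sP] := choice next; exists s.
have phi_cvg : phi j (x (s k).+1) @[k --> \oo] --> phi j xs.
  apply/cvgrPdist_lt => e e0; near=> k.
  have [_ [_]] := sP k; rewrite /= -ball_normE/= => /lt_trans; apply.
  by near: k; exact: near_infty_natSinv_lt (PosNum e0).
split=> // [k|k|].
- by have [] := sP k.
- by have [_ []] := sP k.
have psic := psi_continuous (_ : (phi j @` dom j) (phi j xs)).
have := cvg_comp _ (psi j) phi_cvg (psic _); rewrite phiK//.
have -> : psi j \o (fun k => phi j (x (s k).+1)) = (fun k => x (s k).+1).
  by apply/funext => k /=; rewrite phiK//; have [_ []] := sP k.
by apply; exists xs.
Unshelve. all: by end_near. Qed.

Lemma eq_cvgn (R : realType) (a b : nat -> R) (l : R) :
  a =1 b -> a k @[k --> \oo] --> l -> b k @[k --> \oo] --> l.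
Proof. by move=> /funext ->. Qed.

Lemma le_euclidean_norm (R : realType) (m : nat) (v : 'rV[R]_m) i :
  `|v 0 i| <= euclidean_norm v.
Proof.
rewrite /euclidean_norm -sqrtr_sqr; apply: ler_wsqrtr.
by rewrite (bigD1 i)//= lerDl sumr_ge0// => k _; exact: sqr_ge0.
Qed.

(** * Limits along a subsequence of iterates contained in one chart *)

Section OuterIteration.
Context {R : realType} {n : nat} {M : riemannianManifold R n} {m : nat}.
Variables (f : M -> R) (g : 'I_m -> M -> R).
Hypotheses (f2 : Ck 2 f) (g2 : forall i, Ck 2 (g i)).
Variables (h1 h2 h3 : R -> R).
Hypotheses (h1_forcing : forcing_function h1) (h2_forcing : forcing_function h2)
  (h3_forcing : forcing_function h3).
Variables (p : nat -> M) (y : nat -> 'rV[R]_m) (mu : nat -> R) (xs : M).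
Local Notation j := (chart_at xs).
Hypotheses (mu_pos : forall k, 0 < mu k) (mu_lim : mu @ \oo --> (0 : R))
  (xs_feas : feasible g xs)
  (pj : forall k, dom j (p k))
  (phi_p : phi j (p k) @[k --> \oo] --> phi j xs)
  (stop : forall k, first_order_stop f g h1 h2 (mu k) (p k) (y k)).

Let us := phi j xs.
Let u k := phi j (p k).
Let A := constraint_jac (fun i => g i \o psi j).

Lemma complementarity_cvg i : y k 0 i * g i (p k) @[k --> \oo] --> (0 : R).
Proof.
have bound k : `|y k 0 i * g i (p k) - mu k| <= h2 (mu k).
  have [_ + _ _] := stop k; apply: le_trans.
  apply: le_trans (le_euclidean_norm _ i).
  by rewrite mul_mx_diag !mxE mulrC.
have d0 : y k 0 i * g i (p k) - mu k @[k --> \oo] --> (0 : R).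
  apply: norm_cvg0.
  apply: (@squeeze_cvgr _ _ _ _ (fun=> 0) (h2 \o mu)).
  - by apply: nearW => k; rewrite normr_ge0 bound.
  - exact: cvg_cst.
  - exact: (forcing_cvg0 h2_forcing mu_pos mu_lim).
have D : y k 0 i * g i (p k) - mu k + mu k @[k --> \oo] --> (0 + 0 : R).
  exact: cvgD d0 mu_lim.
by rewrite addr0 in D; apply: eq_cvgn D => k; exact: subrK.
Qed.

Lemma gradL_cvg : tnorm (p k) (gradL f g (p k) (y k)) @[k --> \oo] --> (0 : R).
Proof.
apply: (@squeeze_cvgr _ _ _ _ (fun=> 0) (h1 \o mu)).
- apply: nearW => k; rewrite sqrtr_ge0/=.
  by have [] := stop k.
- exact: cvg_cst.
- exact: (forcing_cvg0 h1_forcing mu_pos mu_lim).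
Qed.

Let xsj : dom j xs. Proof. exact: chart_atP. Qed.

Let Uus : (phi j @` dom j) us. Proof. by exists xs. Qed.

Let g1 a b : Ck_on 1 (phi j @` dom j) (fun z => gram j z a b).
Proof. exact: gram_smooth. Qed.

(* Cauchy-Schwarz against the coordinate vectors, whose norms stay bounded. *)
Lemma coord_gradL_cvg :
  mx_cvg (fun k => gradient_row (f \o psi j) (u k) - y k *m A (u k)) 0.
Proof.
move=> i a; rewrite [X in _ --> X]mxE ord1.
pose P k := gradient_row (f \o psi j) (u k) - y k *m A (u k).
pose ea : 'rV[R]_n := delta_mx 0 a.
have bound k : `|P k 0 a| <=
    tnorm (p k) (gradL f g (p k) (y k)) * Num.sqrt (qform (gram j (u k)) ea).
  have [v vE] := in_chart_surj (pj k) ea.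
  have := metric_cauchy_schwarz (gradL f g (p k) (y k)) v.
  rewrite {2}/tnorm (metric_gradL_in_chart f2 g2 (pj k)) (metric_in_chart _ _ (pj k)) vE.
  suff -> : P k 0 a = (P k *m ea^T) 0 0 by [].
  by rewrite /ea trmx_delta -colE [RHS]mxE.
have gd : mx_differentiable (gram j) us.
  by move=> b c; exact: Ck1_differentiable (image_open j) (g1 b c) Uus.
have H := mx_cvgM (mx_cvgM (mx_cvg_cst ea) (mx_cvg_differentiable phi_p gd))
  (mx_cvg_cst ea^T).
pose N k := tnorm (p k) (gradL f g (p k) (y k)) * Num.sqrt (qform (gram j (u k)) ea).
apply: norm_cvg0; apply: (@squeeze_cvgr _ _ _ _ (fun=> 0) N).
- by apply: nearW => k; rewrite normr_ge0; exact: bound.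
- exact: cvg_cst.
rewrite -[X in _ --> X](mul0r (Num.sqrt (qform (gram j us) ea))).
apply: cvgM; first exact: gradL_cvg.
apply: (cvg_comp (fun k => qform (gram j (u k)) ea) Num.sqrt (H 0 0)).
exact: sqrt_continuous.
Qed.

Lemma outer_iteration_AKKT : p @ \oo --> xs -> AKKT f g xs.
Proof.
move=> p_xs; exists p, y; split => //.
- by move=> k i; have [_ _ _ /(_ i)/ltW] := stop k.
- exact: gradL_cvg.
- rewrite -[X in _ --> X](big1 (I := 'I_m) (idx := 0) (op := +%R) (index_enum _) xpredT (fun=> 0))//.
  apply: cvg_sumr => i _; apply: eq_cvgn (complementarity_cvg i) => k.
  have [_ _ /(_ i) gp /(_ i) yp] := stop k.
  by rewrite max_l// mulr_ge0// ltW.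
Qed.

Let act : pred 'I_m := fun i => i \in active g xs.

(** LICQ concerns gradients, [dual] rows of partial derivatives; the inverse Gram matrix relating
    them is absorbed into the dual vector. *)
Let dual : LICQ g xs -> forall k, exists w : 'cV[R]_n,
  forall i, act i -> (A us *m w) i 0 = (i == k)%:R.
Proof.
move=> /free_dual H k; have [w wP] := H k.
exists (invmx (gram j us) *m w) => i /wP <-.
by rewrite constraint_jacM mulmxA.
Qed.

Let inactive_pos i : ~~ act i -> 0 < (g i \o psi j) us.
Proof.
by rewrite /act inE /= phiK// lt_neqAle eq_sym => ->; exact: xs_feas.
Qed.

Let complementarity i : y k 0 i * (g i \o psi j) (u k) @[k --> \oo] --> (0 : R).
Proof.
by apply: eq_cvgn (complementarity_cvg i) => k /=; rewrite phiK.
Qed.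

Lemma outer_iteration_KKT ys : mx_cvg y ys -> KKT f g xs ys.
Proof.
move=> y_ys.
have y_ge0 k i : 0 <= y k 0 i by have [_ _ _ /(_ i)/ltW] := stop k.
have [E ys_ge0] := multiplier_KKT phi_p (image_open j) Uus (f2 j)
  (fun i => g2 i j) y_ge0 complementarity coord_gradL_cvg y_ys.
split; last first.
  move=> i; have [ys0 yg] := ys_ge0 i; split=> //.
  by move: yg; rewrite /= phiK.
(* By [E] the pairing of [gradL] with itself vanishes, and the metric is definite. *)
apply/eqP; apply: contraTT isT => /(@metric_pos _ _ _ xs).
rewrite (metric_gradL_in_chart f2 g2 xsj) -/us -/A E subrr mul0mx mxE.
by rewrite ltxx.
Qed.

Lemma outer_iteration_second_order :
  (forall k, - h3 (mu k) <= lambda_min (p k) (condensed_hess f g (y k))) ->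
  LICQ g xs -> exists ys, weak_second_order_stationary f g xs ys.
Proof.
move=> lmin /dual licq.
have [ys y_ys] := multiplier_cvg phi_p (image_open j) Uus (f2 j)
  (fun i => g2 i j) inactive_pos complementarity coord_gradL_cvg licq.
exists ys; split; first exact: outer_iteration_KKT.
move=> v v_act.
have -> : metric xs (hessL f g ys v) v =
    hess_form (f \o psi j) (gram j) us (in_chart j xs v) (in_chart j xs v)
    - \sum_i ys 0 i * hess_form (g i \o psi j) (gram j) us
        (in_chart j xs v) (in_chart j xs v).
  apply: etrans (metricB_sum _ _ _ _) _.
  apply: (f_equal2 (fun a b => a - b)).
    exact: (metric_hess_in_chart _ f2 xsj).
  apply: eq_bigr => i _; apply: (f_equal ( *%R (ys 0 i))).
  exact: (metric_hess_in_chart _ (g2 i) xsj).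
apply: (second_order_limit phi_p (image_open j) Uus (f2 j)
  (fun i => g2 i j) g1 (@gram_unit _ _ _ j) inactive_pos complementarity licq
  y_ys (forcing_cvg0 h3_forcing mu_pos mu_lim)).
  move=> i /v_act; rewrite constraint_jacM => <-.
  by rewrite (metric_grad_in_chart _ (g2 i) xsj).
(* The limit argument needs the bound for every coordinate vector [xi]; each is the chart expression
   of some tangent vector [w] at [p k]. *)
move=> k xi; have [w wE] := in_chart_surj (pj k) xi.
have := lambda_min_condensed_hess f2 g2 (y k) w.
rewrite (condensed_hess_in_chart f2 g2 (pj k)) wE.
have -> : metric (p k) w w = qform (gram j (u k)) xi.
  by rewrite (metric_in_chart _ _ (pj k)) wE.
under [X in _ <= _ + X]eq_bigr do rewrite -[g _ (p k)](f_equal _ (phiK (pj k))).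
apply: le_trans; apply: ler_wpM2r; last exact: lmin.
have <- : metric (p k) w w = qform (gram j (u k)) xi.
  by rewrite (metric_in_chart _ _ (pj k)) wE.
exact: metric_ge0.
Qed.

End OuterIteration.

Theorem theorem4p17 (R : realType) (n : nat) (M : riemannianManifold R n)
  (Mconn : connected [set: M]) (Mcomplete : complete_manifold M)
  (m : nat) (f : M -> R) (g : 'I_m -> M -> R)
  (f_C2 : Ck 2 f) (g_C2 : forall i, Ck 2 (g i))
  (h1 h2 h3 : R -> R)
  (h1_forcing : forcing_function h1) (h2_forcing : forcing_function h2)
  (h3_forcing : forcing_function h3)
  (x : nat -> M) (y : nat -> 'rV[R]_m) (mu : nat -> R)
  (x_int : forall k, strictly_feasible g (x k))
  (y_pos : forall k i, 0 < y k 0 i)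
  (mu_pos : forall k, 0 < mu k)
  (mu_lim : mu @ \oo --> (0 : R))
  (xs : M) (xs_feas : feasible g xs) (xs_acc : cluster (x @ \oo) xs) :
  ((forall k, first_order_stop f g h1 h2 (mu k) (x k.+1) (y k.+1)) ->
   AKKT f g xs)
  /\
  ((forall k, first_order_stop f g h1 h2 (mu k) (x k.+1) (y k.+1)) ->
   (forall k, - h3 (mu k) <=
      lambda_min (x k.+1) (condensed_hess f g (y k.+1))) ->
   LICQ g xs ->
   hess_lipschitz_at f xs ->
   (forall i, hess_lipschitz_at (g i) xs) ->
   exists ys : 'rV[R]_m, weak_second_order_stationary f g xs ys).
Proof.
have [s [s_ge sj phi_s x_s]] := cluster_chart_subsequence xs_acc.
have s_oo : s @ \oo --> \oo.
  by apply/cvgnyPge => N; near=> k; apply: leq_trans (s_ge k); near: k; exact: nbhs_infty_ge.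
have mus_lim : mu (s k) @[k --> \oo] --> (0 : R) := cvg_comp s mu s_oo mu_lim.
have mus_pos k : 0 < mu (s k) by [].
pose p k := x (s k).+1; pose z k := y (s k).+1; pose nu k := mu (s k).
split=> [stop|stop lmin licq _ _].
  exact: (@outer_iteration_AKKT _ _ _ _ _ _ _ _ h1_forcing h2_forcing p z nu xs
    mus_pos mus_lim (fun k => stop (s k)) x_s).
exact: (@outer_iteration_second_order _ _ _ _ _ _ f_C2 g_C2 _ _ _
  h1_forcing h2_forcing h3_forcing p z nu xs
  mus_pos mus_lim xs_feas sj phi_s (fun k => stop (s k)) (fun k => lmin (s k)) licq).
Unshelve. all: by end_near. Qed.
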